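(* Let $R$ be a ring and $\mathcal{L} \subseteq \mathrm{Mod}(R)$ a class such that $(\mathcal{P}(R),\mathcal{L})$ is a GP-admissible pair. If $(\mathcal{GP}_{\mathcal{L}},\mathcal{GP}_{\mathcal{L}}^{\perp_1})$ is a complete cotorsion pair, then for each integer $m>0$ the pair $$\left([\mathcal{GP}_{\mathcal{L}}]^{\wedge}_m,\; [\mathcal{P}(R)^{\wedge}_m]^{\perp_1}\cap \mathcal{GP}_{\mathcal{L}}^{\perp_1}\right)$$ is a complete and hereditary cotorsion pair.
   Context: Rings are associative with identity; $\mathrm{Mod}(R)$ is the category of left $R$-modules and $\mathcal{P}(R)$ the class of projective left $R$-modules. $\mathcal{GP}_{\mathcal{L}}$ is the class of cycles of exact complexes of projective left $R$-modules which remain exact after applying $\mathrm{Hom}_R(-,L)$ for all $L\in\mathcal{L}$. A pair $(\mathcal{U},\mathcal{V})$ of classes in $\mathrm{Mod}(R)$ is GP-admissible if: (1) $\mathrm{Ext}^{i}_R(U,V)=0$ for all $i\ge 1$, $U\in\mathcal{U}$, $V\in\mathcal{V}$; (2) for every $A\in\mathrm{Mod}(R)$ there is an epimorphism $U\to A$ with $U\in\mathcal{U}$; (3) $\mathcal{U}$ and $\mathcal{V}$ are closed under finite coproducts; (4) $\mathcal{U}$ is closed under extensions; (5) for every $U\in\mathcal{U}$ there is an exact sequence $0\to U\to W\to U'\to 0$ with $U'\in\mathcal{U}$ and $W\in\mathcal{U}\cap\mathcal{V}$. For a class $\mathcal{X}\subseteq\mathrm{Mod}(R)$, $\mathcal{X}^\wedge_m$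 is the class of modules $M$ admitting an exact sequence $0\to X_k\to\cdots\to X_0\to M\to 0$ with all $X_i\in\mathcal{X}$ and $k\le m$, and $\mathcal{X}^{\perp_1}=\{M : \mathrm{Ext}^1_R(X,M)=0 \text{ for all } X\in\mathcal{X}\}$. A cotorsion pair is a pair $(\mathcal{X},\mathcal{Y})$ of classes in $\mathrm{Mod}(R)$ with $\mathcal{X}=\{M:\mathrm{Ext}^1_R(M,\mathcal{Y})=0\}$ and $\mathcal{Y}=\mathcal{X}^{\perp_1}$. It is complete if every $M\in\mathrm{Mod}(R)$ fits into an exact sequence $0\to Y\to X\to M\to 0$ with $X\in\mathcal{X}$, $Y\in\mathcal{Y}$ (equivalently, into an exact sequence $0\to M\to Y\to X\to 0$ with $Y\in\mathcal{Y}$, $X\in\mathcal{X}$), and hereditary if $\mathrm{Ext}^{i}_R(X,Y)=0$ for all $i\ge1$, $X\in\mathcal{X}$, $Y\in\mathcal{Y}$. *)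

(* Defs.v *)
From mathcomp Require Import all_boot all_order all_algebra.

Set Implicit Arguments.
Unset Strict Implicit.
Unset Printing Implicit Defensive.

Import GRing.Theory.
Local Open Scope ring_scope.

(* A class of left R-modules, i.e. a full subcategory of Mod(R). *)
Definition modclass (R : pzRingType) := lmodType R -> Prop.

Section Modules.
Variable R : pzRingType.
Implicit Types (A B D M N : lmodType R) (C U V X Y : modclass R).

Definition zero_module M : Prop := forall x : M, x = 0.

Definition inj_map (M N : lmodType R) (f : {linear M -> N}) : Prop := injective f.

Definition surj_map (M N : lmodType R) (f : {linear M -> N}) : Prop :=
  forall y : N, exists x : M, f x = y.

Definition exact_at (A B D : lmodType R) (f : {linear A -> B}) (g : {linear B -> D}) : Prop :=
  forall y : B, g y = 0 <-> exists x : A, f x = y.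

Definition short_exact (A B D : lmodType R) (f : {linear A -> B}) (g : {linear B -> D})
  : Prop := [/\ inj_map f, exact_at f g & surj_map g].

Definition projective : modclass R := fun P =>
  forall (A B : lmodType R) (g : {linear A -> B}) (f : {linear P -> B}),
    surj_map g -> exists h : {linear P -> A}, forall x : P, g (h x) = f x.

(* Exact sequences ... -> T_1 -> T_0 -> M -> 0. *)
Record left_resolution M := LeftResolution {
  res_obj :> nat -> lmodType R;
  res_diff : forall n, {linear res_obj n.+1 -> res_obj n};
  res_aug : {linear res_obj 0%N -> M};
  res_aug_surj : surj_map res_aug;
  res_exact0 : exact_at (res_diff 0%N) res_aug;
  res_exactS : forall n, exact_at (res_diff n.+1) (res_diff n)
}.

Definition projective_resolution M (T : left_resolution M) : Prop :=
  forall n, projective (T n).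

(* Cocycles and coboundaries of the deleted complex
   0 -> Hom(T_0, N) -> Hom(T_1, N) -> ... *)
Definition cocycle M N (T : left_resolution M) n (f : {linear T n -> N})
  : Prop := forall x : T n.+1, f (res_diff T n x) = 0.

Definition coboundary M N (T : left_resolution M) n
  : {linear T n -> N} -> Prop :=
  match n return {linear T n -> N} -> Prop with
  | 0 => fun f => forall x, f x = 0
  | k.+1 => fun f =>
      exists g : {linear T k -> N}, forall x, f x = g (res_diff T k x)
  end.

(* Ext^n_R(M, N) = 0.  By the comparison theorem the cohomology does not
   depend on the projective resolution it is computed from. *)
Definition Ext_vanishes n M N : Prop :=
  exists2 T : left_resolution M, projective_resolution T &
    forall f : {linear T n -> N}, cocycle f -> coboundary f.

Definition right_perp1 X : modclass R := fun M =>
  forall A, X A -> Ext_vanishes 1 A M.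

Definition left_perp1 Y : modclass R := fun M =>
  forall B, Y B -> Ext_vanishes 1 M B.

Definition Ext_orthogonal X Y : Prop :=
  forall i A B, (1 <= i)%N -> X A -> Y B -> Ext_vanishes i A B.

Definition class_cap X Y : modclass R := fun M => X M /\ Y M.

(* The bound k on the length is encoded by T_i = 0 for i > k. *)
Definition wedge X m : modclass R := fun M =>
  exists (T : left_resolution M) (k : nat),
    [/\ (k <= m)%N,
        forall i, (i <= k)%N -> X (T i)
      & forall i, (k < i)%N -> zero_module (T i)].

(* With this indexing the differential out of degree i + 1 is [cpx_diff i];
   since i ranges over all of [int], every degree has the form i + 1. *)
Record zcomplex := ZComplex {
  cpx_obj :> int -> lmodType R;
  cpx_diff : forall i : int, {linear cpx_obj (i + 1) -> cpx_obj i};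
  cpx_diffK : forall (i : int) (x : cpx_obj (i + 1 + 1)),
    cpx_diff i (cpx_diff (i + 1) x) = 0
}.

Definition exact_complex (T : zcomplex) : Prop :=
  forall i : int, exact_at (cpx_diff T (i + 1)) (cpx_diff T i).

Definition Hom_exact_complex (T : zcomplex) N : Prop :=
  forall (i : int) (f : {linear T (i + 1) -> N}),
    (forall x, f (cpx_diff T (i + 1) x) = 0) <->
    (exists g : {linear T i -> N}, forall x, f x = g (cpx_diff T i x)).

(* M is (isomorphic to) the kernel of the differential leaving degree i + 1. *)
Definition is_cycle (T : zcomplex) M : Prop :=
  exists (i : int) (j : {linear M -> T (i + 1)}),
    inj_map j /\ exact_at j (cpx_diff T i).

Definition GProj (L : modclass R) : modclass R := fun M =>
  exists T : zcomplex,
    [/\ forall i, projective (T i),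
        exact_complex T,
        forall N, L N -> Hom_exact_complex T N
      & is_cycle T M].

Definition is_coproduct n (F : 'I_n -> lmodType R) M
    (inc : forall i, {linear F i -> M}) : Prop :=
  forall N (f : forall i, {linear F i -> N}),
    exists h : {linear M -> N},
      (forall i x, h (inc i x) = f i x) /\
      (forall h' : {linear M -> N},
         (forall i x, h' (inc i x) = f i x) -> h' =1 h).

(* The empty coproduct (n = 0) is included. *)
Definition coproduct_closed C : Prop :=
  forall n (F : 'I_n -> lmodType R) M (inc : forall i, {linear F i -> M}),
    is_coproduct inc -> (forall i, C (F i)) -> C M.

Definition extension_closed C : Prop :=
  forall (A B D : lmodType R) (f : {linear A -> B}) (g : {linear B -> D}),
    short_exact f g -> C A -> C D -> C B.

Record GP_admissible U V : Prop := GPAdmissible {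
  GPa_ext : Ext_orthogonal U V;
  GPa_epi : forall A : lmodType R,
    exists2 B, U B & exists f : {linear B -> A}, surj_map f;
  GPa_coprodl : coproduct_closed U;
  GPa_coprodr : coproduct_closed V;
  GPa_extension : extension_closed U;
  GPa_cogen : forall A, U A ->
    exists (W A' : lmodType R) (f : {linear A -> W}) (g : {linear W -> A'}),
      [/\ short_exact f g, U A' & class_cap U V W]
}.

Definition cotorsion_pair X Y : Prop :=
  (forall M, X M <-> left_perp1 Y M) /\ (forall M, Y M <-> right_perp1 X M).

Definition complete_pair X Y : Prop :=
  forall M, exists (B A : lmodType R) (f : {linear B -> A})
    (g : {linear A -> M}), [/\ short_exact f g, X A & Y B].

Definition complete_cotorsion_pair X Y : Prop :=
  cotorsion_pair X Y /\ complete_pair X Y.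

Definition hereditary_pair X Y : Prop := Ext_orthogonal X Y.

End Modules.

(* Main.v *)
From HB Require Import structures.
From mathcomp Require Import all_boot all_order all_algebra.
From mathcomp Require Import boolp classical_sets ring.
Require Import Defs.

(** Write GP for GProj L, P_m for the modules of projective dimension at most m,
    GP_m for [wedge (GProj L) m], and Y for the intersection of P_m^perp and GP^perp.

    The complete cotorsion pair (GP, GP^perp) is hereditary because GP contains
    a syzygy of each of its members, and P_m is contained in GP^perp. Every M in GP_m embeds
    in some W in P_m with cokernel in GP, so Ext^1(GP_m, Y) = 0. For
    completeness take 0 -> N -> G -> M -> 0 with G in GP and N in GP^perp,
    embed N in some B in P_m^perp with cokernel A in P_m, and push out along
    N -> G: in 0 -> B -> E -> M -> 0 the module B lies in Y, and E is an
    extension of A by G, hence lies in GP_m. A module orthogonal to Y is then a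
    direct summand of a module in GP_m. Ext^i for i > 1 is handled by passing
    to syzygies.

    The deep ingredient is the embedding N -> B, i.e. the completeness of
    (P_m, P_m^perp). It needs no ordinals. Fix a family of submodules U of a
    projective module F. The module J generated by N together with freely
    adjoined operators extending every linear map U -> J to F is built as a
    quotient of an inductive type of infinitary terms; J is injective relative
    to the family, and freeness forces Ext^1(J/N, Z) = 0 for every Z which is
    injective relative to the family. For the family of all U with F/U in P_m,
    where F is free on a type of terms large enough to generate the subsystems
    below, cosyzygies give J/N in P_m. Conversely, relative injectivity implies
    orthogonality to all W in P_m: by Zorn's lemma one extends a partial section
    of an extension of W along subsystems of a finite projective resolution of W
    that are closed under boundaries, chosen preimages of cycles and dual bases;
    each one-step enlargement has a quotient of the form F/U. *)

Set Implicit Arguments.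
Unset Strict Implicit.
Unset Printing Implicit Defensive.

Import GRing.Theory.
Local Open Scope ring_scope.

(** * Submodules, quotients and short exact sequences *)

Section LinearTools.
Variable R : pzRingType.

Definition submod (M : lmodType R) (U : M -> Prop) : Prop :=
  U 0 /\ forall (r : R) x y, U x -> U y -> U (r *: x + y).

Definition linear_on (M N : lmodType R) (U : M -> Prop) (f : M -> N) : Prop :=
  forall (r : R) x y, U x -> U y -> f (r *: x + y) = r *: f x + f y.

Definition mk_linear (M N : lmodType R) (f : M -> N) (fL : linear f) : {linear M -> N} :=
  HB.pack_for {linear M -> N} f (GRing.isLinear.Build R M N *:%R f fL).

Lemma linear_map (M N : lmodType R) (f : M -> N) :
  linear f -> exists g : {linear M -> N}, forall x, g x = f x.
Proof. by move=> fL; exists (mk_linear fL). Qed.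

(** Closure under differences turns the condition at 0 into single-valuedness. Maps defined through
    chosen preimages or representatives are obtained in this way throughout. *)
Lemma linear_rel (M N : lmodType R) (G : M -> N -> Prop) :
    (forall x, exists y, G x y) ->
    (forall r x x' y y', G x y -> G x' y' -> G (r *: x + x') (r *: y + y')) ->
    (forall y, G 0 y -> y = 0) ->
  exists f : {linear M -> N}, forall x, G x (f x).
Proof.
move=> /choice [f fP] GL G0.
have Gf x y y' : G x y -> G x y' -> y = y'.
  move=> Gy Gy'; apply/eqP; rewrite -subr_eq0; apply/eqP/G0.
  by have := GL (-1) _ _ _ _ Gy' Gy; rewrite !scaleN1r addNr addrC.
have fL : linear f by move=> r x y; apply: Gf (fP _) _; apply: GL.
by exists (mk_linear fL).
Qed.

Lemma linear_onD (M N : lmodType R) (U : M -> Prop) (f : M -> N) :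
  linear_on U f -> forall x y, U x -> U y -> f (x + y) = f x + f y.
Proof. by move=> fL x y Ux Uy; have := fL 1 x y Ux Uy; rewrite !scale1r. Qed.

Lemma linear_on0 (M N : lmodType R) (U : M -> Prop) (f : M -> N) :
  U 0 -> linear_on U f -> f 0 = 0.
Proof.
move=> U0 /linear_onD fD; have := fD 0 0 U0 U0; rewrite addr0 => /eqP.
by rewrite -subr_eq0 opprD addrA subrr sub0r oppr_eq0 => /eqP.
Qed.

Lemma linear_onZ (M N : lmodType R) (U : M -> Prop) (f : M -> N) :
  U 0 -> linear_on U f -> forall r x, U x -> f (r *: x) = r *: f x.
Proof.
by move=> U0 fL r x Ux; have := fL r x 0 Ux U0; rewrite (linear_on0 U0 fL) !addr0.
Qed.

Section Submod.
Variables (M : lmodType R) (U : M -> Prop).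
Hypothesis Usub : submod U.

Lemma submod0 : U 0. Proof. by case: Usub. Qed.
Lemma submodD x y : U x -> U y -> U (x + y).
Proof. by move=> Ux Uy; rewrite -[x]scale1r; apply: Usub.2. Qed.
Lemma submodZ r x : U x -> U (r *: x).
Proof. by move=> Ux; rewrite -[r *: x]addr0; apply: Usub.2 => //; apply: submod0. Qed.
Lemma submodN x : U x -> U (- x).
Proof. by rewrite -scaleN1r; apply: submodZ. Qed.
Lemma submodB x y : U x -> U y -> U (x - y).
Proof. by move=> Ux Uy; apply/submodD/submodN. Qed.

End Submod.

Lemma submod_ker (M N : lmodType R) (f : {linear M -> N}) : submod (fun x => f x = 0).
Proof.
split=> [|r x y fx fy]; first exact: linear0.
by rewrite linearP fx fy scaler0 addr0.
Qed.

Lemma submod_im (M N : lmodType R) (f : {linear M -> N}) : submod (fun y => exists x, f x = y).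
Proof.
split=> [|r _ _ [x <-] [y <-]]; first by exists 0; rewrite linear0.
by exists (r *: x + y); rewrite linearP.
Qed.

Lemma submod_image (M N : lmodType R) (f : {linear M -> N}) U :
  submod U -> submod (fun y => exists2 x, U x & f x = y).
Proof.
move=> Us; split=> [|r _ _ [x Ux <-] [y Uy <-]].
  by exists 0; rewrite ?linear0 //; apply: submod0.
by exists (r *: x + y); rewrite ?linearP //; apply: Us.2.
Qed.

Lemma submod_preim (M N : lmodType R) (f : {linear M -> N}) U :
  submod U -> submod (fun x => U (f x)).
Proof.
move=> Us; split=> [|r x y Ux Uy]; first by rewrite linear0; apply: submod0.
by rewrite linearP; apply: Us.2.
Qed.

Lemma injP (M N : lmodType R) (f : {linear M -> N}) :
  inj_map f <-> (forall x, f x = 0 -> x = 0).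
Proof.
split=> [fI x fx|f0 x y fxy]; first by apply: fI; rewrite fx linear0.
by apply/eqP; rewrite -subr_eq0; apply/eqP/f0; rewrite linearB fxy subrr.
Qed.

Lemma inj0 (M N : lmodType R) (f : {linear M -> N}) : inj_map f -> forall x, f x = 0 -> x = 0.
Proof. by move/injP. Qed.

End LinearTools.

(** * Quotients of setoids with module operations *)

Section SetoidModule.
Variables (R : pzRingType) (T : Type) (e : T -> T -> Prop).
Variables (z : T) (add : T -> T -> T) (opp : T -> T) (scl : R -> T -> T).
Hypotheses (e_refl : forall x, e x x) (e_sym : forall x y, e x y -> e y x)
  (e_trans : forall x y t, e x y -> e y t -> e x t).
Hypotheses (e_add : forall x x' y y', e x x' -> e y y' -> e (add x y) (add x' y'))
  (e_opp : forall x x', e x x' -> e (opp x) (opp x'))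
  (e_scl : forall r x x', e x x' -> e (scl r x) (scl r x')).
Hypotheses (addA : forall x y t, e (add x (add y t)) (add (add x y) t))
  (addC : forall x y, e (add x y) (add y x))
  (add0 : forall x, e (add z x) x)
  (addN : forall x, e (add (opp x) x) z)
  (sclA : forall a b x, e (scl a (scl b x)) (scl (a * b) x))
  (scl1 : forall x, e (scl 1 x) x)
  (sclDr : forall a x y, e (scl a (add x y)) (add (scl a x) (scl a y)))
  (sclDl : forall x a b, e (scl (a + b) x) (add (scl a x) (scl b x))).

(** Classes are predicates of the form [e t], so that equality in the quotient is equivalence, by
    functional and propositional extensionality. *)
Definition setoid_quot := {C : T -> Prop | exists t, C = e t}.
Definition setoid_pi (t : T) : setoid_quot := exist _ (e t) (ex_intro _ t erefl).

Lemma setoid_piP t t' : setoid_pi t = setoid_pi t' <-> e t t'.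
Proof.
split=> [/(congr1 (fun q => sval q t')) /= ->|ett'] //.
apply: eq_exist => /=; apply/funext => u; apply/propext.
by split; apply: e_trans => //; apply: e_sym.
Qed.

Lemma setoid_pi_surj q : exists t, setoid_pi t = q.
Proof. by case: q => C [t Ct]; exists t; apply: eq_exist. Qed.

Definition setoid_repr q : T := sval (cid (setoid_pi_surj q)).
Lemma setoid_reprK q : setoid_pi (setoid_repr q) = q.
Proof. exact: svalP (cid (setoid_pi_surj q)). Qed.
Lemma setoid_pi_repr t : e (setoid_repr (setoid_pi t)) t.
Proof. by apply/setoid_piP; rewrite setoid_reprK. Qed.

Let qadd p q := setoid_pi (add (setoid_repr p) (setoid_repr q)).
Let qopp p := setoid_pi (opp (setoid_repr p)).
Let qscl r p := setoid_pi (scl r (setoid_repr p)).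

Let qaddE x y : qadd (setoid_pi x) (setoid_pi y) = setoid_pi (add x y).
Proof. by apply/setoid_piP/e_add; apply: setoid_pi_repr. Qed.
Let qoppE x : qopp (setoid_pi x) = setoid_pi (opp x).
Proof. by apply/setoid_piP/e_opp; apply: setoid_pi_repr. Qed.
Let qsclE r x : qscl r (setoid_pi x) = setoid_pi (scl r x).
Proof. by apply/setoid_piP/e_scl; apply: setoid_pi_repr. Qed.

Let qaddA : associative qadd.
Proof.
move=> p q r; rewrite -(setoid_reprK p) -(setoid_reprK q) -(setoid_reprK r).
by rewrite !qaddE; apply/setoid_piP.
Qed.
Let qaddC : commutative qadd.
Proof. by move=> p q; apply/setoid_piP. Qed.
Let qadd0 : left_id (setoid_pi z) qadd.
Proof. by move=> p; rewrite -(setoid_reprK p) qaddE; apply/setoid_piP. Qed.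
Let qaddN : left_inverse (setoid_pi z) qopp qadd.
Proof. by move=> p; rewrite -(setoid_reprK p) qoppE qaddE; apply/setoid_piP. Qed.

HB.instance Definition _ := gen_eqMixin setoid_quot.
HB.instance Definition _ := gen_choiceMixin setoid_quot.
HB.instance Definition _ :=
  GRing.isZmodule.Build setoid_quot qaddA qaddC qadd0 qaddN.

Let qsclA a b v : qscl a (qscl b v) = qscl (a * b) v.
Proof. by rewrite -(setoid_reprK v) !qsclE; apply/setoid_piP. Qed.
Let qscl1 : left_id 1 qscl.
Proof. by move=> v; rewrite -(setoid_reprK v) !qsclE; apply/setoid_piP. Qed.
Let qsclDr : right_distributive qscl +%R.
Proof.
move=> a u v; rewrite -(setoid_reprK v) -(setoid_reprK u).
rewrite [LHS](congr1 (qscl a) (qaddE _ _)) !qsclE [RHS]qaddE.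
exact/setoid_piP.
Qed.
Let qsclDl v : {morph qscl^~ v : a b / a + b}.
Proof.
by move=> a b; rewrite -(setoid_reprK v) !qsclE [RHS]qaddE; apply/setoid_piP.
Qed.

HB.instance Definition _ :=
  GRing.Zmodule_isLmodule.Build R setoid_quot qsclA qscl1 qsclDr qsclDl.

(** Submodules, quotients, modules of terms and injective modules all come from this one
    construction. *)
Lemma setoid_module : exists (Q : lmodType R) (p : T -> Q),
  [/\ forall q, exists t, p t = q, forall t t', p t = p t' <-> e t t', p z = 0,
      forall x y, p (add x y) = p x + p y & forall r x, p (scl r x) = r *: p x].
Proof.
exists (setoid_quot : lmodType R), setoid_pi; split=> [||//|x y|r x].
- exact: setoid_pi_surj.
- exact: setoid_piP.
- by rewrite [RHS]qaddE.
- by rewrite [RHS]qsclE.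
Qed.

End SetoidModule.

(** * Submodules, quotient modules, pullbacks and pushouts *)

Section Constructions.
Variable R : pzRingType.
Implicit Types (A B D M N P Q Z : lmodType R).

Lemma sub_module M (U : M -> Prop) : submod U ->
  exists (S : lmodType R) (i : {linear S -> M}),
    inj_map i /\ forall x, U x <-> exists s, i s = x.
Proof.
move=> Us; pose T := {x | U x}.
pose z : T := exist _ 0 (submod0 Us).
pose add (x y : T) : T := exist _ (sval x + sval y) (submodD Us (svalP x) (svalP y)).
pose opp (x : T) : T := exist _ (- sval x) (submodN Us (svalP x)).
pose scl r (x : T) : T := exist _ (r *: sval x) (submodZ Us r (svalP x)).
have [] := @setoid_module R T (fun x y => sval x = sval y) z add opp scl; rewrite /= ?/add /=.
- by [].
- by move=> x y ->.
- by move=> x y t -> ->.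
- by move=> x x' y y' -> ->.
- by move=> x x' ->.
- by move=> r x x' ->.
- by move=> *; rewrite addrA.
- by move=> *; rewrite addrC.
- by move=> *; rewrite add0r.
- by move=> *; rewrite addNr.
- by move=> *; rewrite scalerA.
- by move=> *; rewrite scale1r.
- by move=> *; rewrite scalerDr.
- by move=> *; rewrite scalerDl.
move=> S [p [psurj pP p0 pD pZ]].
have [] := @linear_rel R S M (fun s x => exists2 t, p t = s & sval t = x).
- by move=> s; have [t <-] := psurj s; exists (sval t), t.
- move=> r _ _ _ _ [t <- <-] [t' <- <-].
  by exists (add (scl r t) t'); rewrite ?pD ?pZ.
- by move=> _ [t pt <-]; move: pt; rewrite -p0 => /pP.
move=> i iP; exists S, i.
have ip t : i (p t) = sval t by have [t' /pP <-] := iP (p t).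
split=> [s s'|x].
  by have [[t <-] [t' <-]] := (psurj s, psurj s'); rewrite !ip => /pP.
split=> [Ux|[s <-]]; first by exists (p (exist _ x Ux)); rewrite ip.
by have [t <-] := psurj s; rewrite ip; apply: svalP.
Qed.

Lemma quot_module M (U : M -> Prop) : submod U ->
  exists (Q : lmodType R) (p : {linear M -> Q}),
    surj_map p /\ forall x, p x = 0 <-> U x.
Proof.
move=> Us.
have [] := @setoid_module R M (fun x y => U (x - y)) 0 +%R -%R *:%R.
- by move=> x; rewrite subrr; apply: submod0.
- by move=> x y /(submodN Us); rewrite opprB.
- by move=> x y t Uxy Uyt; rewrite -[x](subrK y) -addrA; apply: submodD.
- by move=> x x' y y' Ux Uy; rewrite opprD addrACA; apply: submodD.
- by move=> x x' Ux; rewrite -opprD; apply: submodN.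
- by move=> r x x' Ux; rewrite -scalerBr; apply: submodZ.
- by move=> *; rewrite addrA subrr; apply: submod0.
- by move=> x y; rewrite [x + y]addrC subrr; apply: submod0.
- by move=> *; rewrite add0r subrr; apply: submod0.
- by move=> *; rewrite addNr subrr; apply: submod0.
- by move=> *; rewrite scalerA subrr; apply: submod0.
- by move=> *; rewrite scale1r subrr; apply: submod0.
- by move=> *; rewrite scalerDr subrr; apply: submod0.
- by move=> *; rewrite scalerDl subrr; apply: submod0.
move=> Q [p [psurj pP p0 pD pZ]].
have pL : linear p by move=> r x y; rewrite pD pZ.
exists Q, (mk_linear pL); split=> // x.
by rewrite -p0 /= pP subr0.
Qed.

Definition ses A B D : Prop :=
  exists (f : {linear A -> B}) (g : {linear B -> D}), short_exact f g.

Lemma ses_of_surj B D (g : {linear B -> D}) : surj_map g ->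
  exists (K : lmodType R) (i : {linear K -> B}), short_exact i g.
Proof.
move=> gs; have [K [i [iI iP]]] := sub_module (submod_ker g).
by exists K, i; split=> // y; rewrite iP.
Qed.

Lemma ses_of_inj A B (f : {linear A -> B}) : inj_map f ->
  exists (D : lmodType R) (g : {linear B -> D}), short_exact f g.
Proof.
move=> fI; have [D [g [gs gP]]] := quot_module (submod_im f).
by exists D, g; split=> // y; rewrite gP.
Qed.

Lemma pullback A B D (f : {linear A -> D}) (g : {linear B -> D}) :
  exists (Z : lmodType R) (p : {linear Z -> A}) (q : {linear Z -> B}),
  [/\ forall w, f (p w) = g (q w),
      forall a b, f a = g b -> exists2 w, p w = a & q w = b
    & forall w, p w = 0 -> q w = 0 -> w = 0].
Proof.
have Us : @submod R (A * B)%type (fun x => f x.1 = g x.2).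
  split=> [|r x y /= fx fy]; first by rewrite /= !linear0.
  by rewrite !linearP /= fx fy.
have [Z [i [iI iP]]] := sub_module Us.
have pL : linear (fun w => (i w).1) by move=> r x y; rewrite linearP.
have qL : linear (fun w => (i w).2) by move=> r x y; rewrite linearP.
exists Z, (mk_linear pL), (mk_linear qL) => /=; split.
- by move=> w; apply/iP; exists w.
- by move=> a b /(iP (a, b)) [w iw]; exists w; rewrite iw.
- move=> w pw qw; apply: iI; rewrite linear0.
  by rewrite [i w]surjective_pairing pw qw.
Qed.

(** In the pullback of B -> D <- P the kernel of each projection is the kernel of the opposite
    map. *)
Lemma pullback_ses A B D K P : ses A B D -> ses K P D ->
  exists2 Z : lmodType R, ses A Z P & ses K Z B.
Proof.
move=> [f [g [fI fg gs]]] [h [k [hI hk ks]]].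
have [Z [p [q [pq pqE pq0]]]] := pullback g k.
exists Z.
  have [] := @linear_rel R A Z (fun a w => p w = f a /\ q w = 0).
  - move=> a; have [|w pw qw] := pqE (f a) 0; last by exists w.
    by rewrite linear0; apply/fg; exists a.
  - by move=> r x x' y y' [py qy] [py' qy']; rewrite !linearP py qy py' qy' scaler0 addr0.
  - by move=> w [pw qw]; apply: pq0; rewrite // pw linear0.
  move=> i iP; exists i, q; split.
  - apply/injP => a ia; have [+ _] := iP a; rewrite ia linear0 => /esym.
    exact: inj0.
  - move=> w; split=> [qw|[a <-]]; last by have [_ ->] := iP a.
    have [|a fa] := (fg (p w)).1; first by rewrite pq qw linear0.
    exists a; apply/eqP; rewrite -subr_eq0; apply/eqP; have [pi qi] := iP a.
    by apply: pq0; rewrite linearB ?pi ?qi ?fa ?qw subrr.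
  - by move=> y; have [b gb] := gs (k y); have [w _ qw] := pqE _ _ gb; exists w.
have [] := @linear_rel R K Z (fun a w => q w = h a /\ p w = 0).
- move=> a; have [|w pw qw] := pqE 0 (h a); last by exists w.
  by rewrite linear0; apply/esym/hk; exists a.
- by move=> r x x' y y' [py qy] [py' qy']; rewrite !linearP py qy py' qy' scaler0 addr0.
- by move=> w [pw qw]; apply: pq0; rewrite // pw linear0.
move=> i iP; exists i, p; split.
- apply/injP => a ia; have [+ _] := iP a; rewrite ia linear0 => /esym.
  exact: inj0.
- move=> w; split=> [pw|[a <-]]; last by have [_ ->] := iP a.
  have [|a fa] := (hk (q w)).1; first by rewrite -pq pw linear0.
  exists a; apply/eqP; rewrite -subr_eq0; apply/eqP; have [qi pi] := iP a.
  by apply: pq0; rewrite linearB ?pi ?qi ?fa ?pw subrr.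
- by move=> y; have [b gb] := ks (g y); have [w pw _] := pqE _ _ (esym gb); exists w.
Qed.

(** E is the product of P and W modulo the pairs [(f y, - h y)]; pushing out does not change the two
    cokernels. *)
Lemma pushout_ses K P M W G : ses K P M -> ses K W G ->
  exists2 E : lmodType R, ses W E M & ses P E G.
Proof.
move=> [f [g [fI fg gs]]] [h [k [hI hk ks]]].
have Us : @submod R (P * W)%type (fun x => exists y, f y = x.1 /\ h y = - x.2).
  split=> [|r x x' [y [fy hy]] [y' [fy' hy']]].
    by exists 0; rewrite !linear0; split=> //; apply/eqP; rewrite eq_sym oppr_eq0.
  exists (r *: y + y'); rewrite !linearP /= fy fy' hy hy'; split=> //=; rewrite ?scalerN ?opprD.
have [E [p [ps pP]]] := quot_module Us.
have uL : linear (fun x : P => p (x, 0)).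
  by move=> r x x'; rewrite -linearP; congr (p (_, _)); rewrite /= scaler0 addr0.
have vL : linear (fun x : W => p (0, x)).
  by move=> r x x'; rewrite -linearP; congr (p (_, _)); rewrite /= scaler0 addr0.
exists E.
- have [] := @linear_rel R E M (fun e m => exists2 x, p x = e & g x.1 = m).
  + by move=> e; have [x px] := ps e; exists (g x.1), x.
  + move=> r _ _ _ _ [x <- <-] [x' <- <-]; by exists (r *: x + x'); rewrite !linearP.
  + by move=> _ [x /pP [y [fy _]] <-]; apply/fg; exists y.
  move=> q qP; have qp x : q (p x) = g x.1.
    have [x' pxx' <-] := qP (p x); apply/esym/eqP; rewrite -subr_eq0 -linearB; apply/eqP.
    have /pP [y [fy _]] : p (x - x') = 0 by rewrite linearB pxx' subrr.
    by apply/fg; exists y.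
  exists (mk_linear vL), q; split.
  + apply/injP => x /= /pP [y /= [fy hy]].
    have y0 : y = 0 by apply: (inj0 fI).
    by rewrite y0 linear0 in hy; rewrite -[x]opprK -hy oppr0.
  + move=> e; have [[a b] <-] := ps e; rewrite qp /=; split=> [/fg [y fy]|[x]].
      exists (b + h y); apply/eqP; rewrite -subr_eq0 -linearB; apply/eqP/pP.
      exists (- y); rewrite /= !linearN fy; split; first by rewrite sub0r.
      by rewrite addrC addKr.
    move=> /eqP; rewrite eq_sym -subr_eq0 -linearB => /eqP /pP [y /= [fy _]].
    by rewrite subr0 in fy; apply/fg; exists y.
  + by move=> m; have [x gx] := gs m; exists (p (x, 0)); rewrite qp.
- have [] := @linear_rel R E G (fun e m => exists2 x, p x = e & k x.2 = m).
  + by move=> e; have [x px] := ps e; exists (k x.2), x.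
  + move=> r _ _ _ _ [x <- <-] [x' <- <-]; by exists (r *: x + x'); rewrite !linearP.
  + move=> _ [x /pP [y [_ hy]] <-]; apply/hk; exists (- y).
    by rewrite linearN hy opprK.
  move=> q qP; have qp x : q (p x) = k x.2.
    have [x' pxx' <-] := qP (p x); apply/eqP; rewrite -subr_eq0 -linearB; apply/eqP.
    have /pP [y [_ hy]] : p (x - x') = 0 by rewrite linearB pxx' subrr.
    by apply/hk; exists y; rewrite hy /= opprB.
  exists (mk_linear uL), q; split.
  + apply/injP => x /= /pP [y /= [fy hy]].
    have y0 : y = 0 by apply: (inj0 hI) => //; rewrite hy oppr0.
    by rewrite -fy y0 linear0.
  + move=> e; have [[a b] <-] := ps e; rewrite qp /=; split=> [/hk [y hy]|[x]].
      exists (a + f y); apply/eqP; rewrite -subr_eq0 -linearB; apply/eqP/pP.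
      exists y; rewrite /= hy; split; first by rewrite addrC addKr.
      by rewrite sub0r opprK.
    move=> /eqP; rewrite -subr_eq0 -linearB => /eqP /pP [y /= [_ hy]].
    by rewrite sub0r opprK in hy; apply/hk; exists y.
  + by move=> m; have [x gx] := ks m; exists (p (0, x)); rewrite qp.
Qed.

(** Z is the kernel of the composite P -> C -> D, and P -> C restricts to a surjection from Z onto
    N. *)
Lemma ses_surj_comp K P C N D : ses K P C -> ses N C D ->
  exists2 Z : lmodType R, ses Z P D & ses K Z N.
Proof.
move=> [f [g [fI fg gs]]] [h [k [hI hk ks]]].
have kgL : linear (k \o g) by move=> r x y; rewrite /= !linearP.
have kgs : surj_map (mk_linear kgL).
  by move=> d; have [c <-] := ks d; have [x <-] := gs c; exists x.
have [Z [i [iI ikg _]]] := ses_of_surj kgs.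
exists Z; first by exists i, (mk_linear kgL).
have [] := @linear_rel R K Z (fun a w => i w = f a).
- by move=> a; apply/ikg; rewrite /= (_ : g _ = 0) ?linear0 //; apply/fg; exists a.
- by move=> r x x' y y'; rewrite !linearP => -> ->.
- by move=> w; rewrite linear0; apply: inj0.
move=> u uP; have [] := @linear_rel R Z N (fun w n => h n = g (i w)).
- by move=> w; apply/hk/(ikg (i w)); exists w.
- by move=> r x x' y y'; rewrite !linearP => -> ->.
- by move=> w; rewrite !linear0; apply: inj0.
move=> v vP; exists u, v; split.
- by apply/injP => a ua; apply: (inj0 fI) => //; rewrite -uP ua linear0.
- move=> w; split=> [vw|[a <-]].
    have [|a fa] := (fg (i w)).1; first by rewrite -vP vw linear0.
    by exists a; apply: iI; rewrite uP.
  by apply: hI; rewrite vP uP linear0; apply/fg; exists a.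
- move=> n; have [x gx] := gs (h n).
  have [|w iw] := (ikg x).1; first by rewrite /= gx; apply/hk; exists n.
  by exists w; apply: hI; rewrite vP iw.
Qed.

(** Dual to [ses_surj_comp]: V is the cokernel of the composite W -> E -> P. *)
Lemma ses_inj_comp W E M P G : ses W E M -> ses E P G ->
  exists2 V : lmodType R, ses W P V & ses M V G.
Proof.
move=> [f [g [fI fg gs]]] [h [k [hI hk ks]]].
have hfL : linear (h \o f) by move=> r x y; rewrite /= !linearP.
have hfI : inj_map (mk_linear hfL) by move=> x y /= /hI /fI.
have [V [q [_ hfq qs]]] := ses_of_inj hfI.
exists V; first by exists (mk_linear hfL), q.
have [] := @linear_rel R M V (fun m v => exists2 e, g e = m & q (h e) = v).
- by move=> m; have [e ge] := gs m; exists (q (h e)), e.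
- by move=> r _ _ _ _ [e <- <-] [e' <- <-]; exists (r *: e + e'); rewrite !linearP.
- by move=> _ [e /fg [w <-] <-]; apply/hfq; exists w.
move=> u uP; have [] := @linear_rel R V G (fun v n => exists2 x, q x = v & k x = n).
- by move=> v; have [x qx] := qs v; exists (k x), x.
- by move=> r _ _ _ _ [e <- <-] [e' <- <-]; exists (r *: e + e'); rewrite !linearP.
- by move=> _ [x /hfq [w <-] <-]; apply/hk; exists (f w).
move=> v vP.
have ug e : u (g e) = q (h e).
  have [e' gee' <-] := uP (g e); apply/eqP; rewrite -subr_eq0 -!linearB; apply/eqP/hfq.
  by have /fg [w <-] : g (e' - e) = 0; [rewrite linearB gee' subrr|exists w].
have vq x : v (q x) = k x.
  have [x' qxx' <-] := vP (q x); apply/eqP; rewrite -subr_eq0 -!linearB; apply/eqP/hk.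
  by have /hfq [w <-] : q (x' - x) = 0; [rewrite linearB qxx' subrr|exists (f w)].
exists u, v; split.
- apply/injP => m; have [e <-] := gs m; rewrite ug => /hfq [w /= /hI <-].
  by apply/fg; exists w.
- move=> w; have [x <-] := qs w; rewrite vq; split=> [/hk [e <-]|[m]].
    by exists (g e); rewrite ug.
  have [e <-] := gs m; rewrite ug => /eqP; rewrite eq_sym -subr_eq0 -linearB.
  move=> /eqP /hfq [y /= hfy]; apply/hk; exists (e + f y).
  by rewrite linearD hfy addrC subrK.
- by move=> n; have [x <-] := ks n; exists (q x); rewrite vq.
Qed.

End Constructions.

Lemma Zorn_set T (good : set T -> Prop) (A0 : set T) : good A0 ->
    (forall F : set (set T), (exists A, F A) -> (forall A, F A -> good A) ->
       (forall A B, F A -> F B -> (A `<=` B \/ B `<=` A)%classic) ->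
       good (fun x => exists2 A, F A & A x)) ->
  exists A, good A /\ forall B, (A `<=` B)%classic -> good B -> (B `<=` A)%classic.
Proof.
move=> gA0 gU.
have [F FP Ftot|A [AP Amax]] := @Zorn_bigcup T (fun A => A = set0 \/ good A).
  case: (pselect (exists2 A, F A & good A)) => [[A FA gA]|nF]; last first.
    left; rewrite -subset0 => x [A FA Ax].
    have [A00|gA] := FP _ FA; first by rewrite A00 in Ax.
    by case: nF; exists A.
  right; have -> : (\bigcup_(X in F) X)%classic =
      (fun x => exists2 A, (F A /\ good A) & A x) :> set T.
    apply/seteqP; split=> [x [B FB Bx]|x [B [FB _] Bx]]; last by exists B.
    exists B => //; split=> //.
    by have [B0|//] := FP _ FB; rewrite B0 in Bx.
  apply: gU => [|B []//|B C [FB _] [FC _]]; first by exists A.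
  exact: Ftot.
have maxA B : (A `<=` B)%classic -> good B -> (B `<=` A)%classic.
  move=> AB gB; apply: contrapT => nBA.
  by apply: (Amax B); [split|right].
case: AP => [A00|gA]; last by exists A.
exists A0; split=> // B _ gB x Bx.
by have := maxA B; rewrite A00 => /(_ (@sub0set _ _) gB x Bx).
Qed.

(** * Modules with freely adjoined extension operators *)

(* [E x r y t] imposes the relation x = r y + t on the generators. The term
   [SExt U f y] stands for the value at y : F of a chosen linear extension of
   the restriction of f to U; for U outside UU it is identified with 0, so that
   the empty family gives free modules. Taking f on all of F rather than on U
   keeps the terms and the relation two ordinary inductive types: linearity of
   f on U is a premise of [seqv_extE]. *)
Section SkolemHull.
Variables (R : pzRingType) (F : lmodType R) (UU : (F -> Prop) -> Prop).
Variables (X : Type) (E : X -> R -> X -> X -> Prop).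

Inductive sterm : Type :=
| SGen of X
| SZero
| SAdd of sterm & sterm
| SOpp of sterm
| SScale of R & sterm
| SExt of (F -> Prop) & (F -> sterm) & F.

Inductive seqv : sterm -> sterm -> Prop :=
| seqv_refl x : seqv x x
| seqv_sym x y : seqv x y -> seqv y x
| seqv_trans x y t : seqv x y -> seqv y t -> seqv x t
| seqv_add x x' y y' : seqv x x' -> seqv y y' -> seqv (SAdd x y) (SAdd x' y')
| seqv_opp x x' : seqv x x' -> seqv (SOpp x) (SOpp x')
| seqv_scale r x x' : seqv x x' -> seqv (SScale r x) (SScale r x')
| seqv_ext U f f' y : (forall x, seqv (f x) (f' x)) -> seqv (SExt U f y) (SExt U f' y)
| seqv_addA x y t : seqv (SAdd x (SAdd y t)) (SAdd (SAdd x y) t)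
| seqv_addC x y : seqv (SAdd x y) (SAdd y x)
| seqv_add0 x : seqv (SAdd SZero x) x
| seqv_addN x : seqv (SAdd (SOpp x) x) SZero
| seqv_scaleA a b x : seqv (SScale a (SScale b x)) (SScale (a * b) x)
| seqv_scale1 x : seqv (SScale 1 x) x
| seqv_scaleDr a x y : seqv (SScale a (SAdd x y)) (SAdd (SScale a x) (SScale a y))
| seqv_scaleDl x a b : seqv (SScale (a + b) x) (SAdd (SScale a x) (SScale b x))
| seqv_gen x r y t : E x r y t -> seqv (SGen x) (SAdd (SScale r (SGen y)) (SGen t))
| seqv_extL U f r x y :
    seqv (SExt U f (r *: x + y)) (SAdd (SScale r (SExt U f x)) (SExt U f y))
| seqv_extE U f x : UU U ->
    (forall r y t, U y -> U t -> seqv (f (r *: y + t)) (SAdd (SScale r (f y)) (f t))) ->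
    U x -> seqv (SExt U f x) (f x)
| seqv_ext0 U f x : ~ UU U -> seqv (SExt U f x) SZero.

Section Interpretation.
Variables (Z : lmodType R) (g : X -> Z) (o : (F -> Prop) -> (F -> Z) -> F -> Z).
Hypotheses (gE : forall x r y t, E x r y t -> g x = r *: g y + g t)
  (oL : forall U f, linear (o U f))
  (oE : forall U f x, UU U -> linear_on U f -> U x -> o U f x = f x).

Fixpoint seval (t : sterm) : Z :=
  match t with
  | SGen x => g x
  | SZero => 0
  | SAdd x y => seval x + seval y
  | SOpp x => - seval x
  | SScale r x => r *: seval x
  | SExt U f y => if pselect (UU U) then o U (fun x => seval (f x)) y else 0
  end.

Lemma seval_eqv s t : seqv s t -> seval s = seval t.
Proof.
elim=> {s t} //=.
- by move=> x y t _ -> _ ->.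
- by move=> x x' y y' _ -> _ ->.
- by move=> x x' _ ->.
- by move=> r x x' _ ->.
- move=> U f f' y _ ff'; case: pselect => //= _; congr (o U _ y).
  exact/funext.
- by move=> *; rewrite addrA.
- by move=> *; rewrite addrC.
- by move=> *; rewrite add0r.
- by move=> *; rewrite addNr.
- by move=> *; rewrite scalerA.
- by move=> *; rewrite scale1r.
- by move=> *; rewrite scalerDr.
- by move=> *; rewrite scalerDl.
- move=> U f r x y; case: pselect => /= [_|_]; first by rewrite oL.
  by rewrite scaler0 addr0.
- move=> U f x UUU _ fL Ux; case: pselect => //= _.
  by rewrite oE // => r y t Uy Ut; apply: fL.
- by move=> U f x nU; case: pselect.
Qed.

End Interpretation.

(** J is the term model: evaluation of terms gives the universal property, induction on terms the
    last clause. *)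
Lemma skolem_hull : exists (J : lmodType R) (g : X -> J) (o : (F -> Prop) -> (F -> J) -> F -> J),
  [/\ [/\ forall x r y t, E x r y t -> g x = r *: g y + g t,
          forall U f, linear (o U f)
        & forall U f x, UU U -> linear_on U f -> U x -> o U f x = f x],
      forall (Z : lmodType R) (g' : X -> Z) (o' : (F -> Prop) -> (F -> Z) -> F -> Z),
        (forall x r y t, E x r y t -> g' x = r *: g' y + g' t) ->
        (forall U f, linear (o' U f)) ->
        (forall U f x, UU U -> linear_on U f -> U x -> o' U f x = f x) ->
        exists h : {linear J -> Z}, (forall x, h (g x) = g' x) /\
          forall U f y, UU U -> h (o U f y) = o' U (fun x => h (f x)) y
    & forall V, submod V -> (forall x, V (g x)) ->
        (forall U f y, UU U -> (forall x, V (f x)) -> V (o U f y)) -> forall x, V x].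
Proof.
have [] := @setoid_module R sterm seqv SZero SAdd SOpp SScale; try by constructor.
- by move=> x y t; apply: seqv_trans.
move=> J [p [psurj pP p0 pD pZ]].
have [rp rpK] := choice psurj.
(* The operator acts on chosen representative terms; by [seqv_ext] the choice is immaterial. *)
pose o (U : F -> Prop) (f : F -> J) (y : F) := p (SExt U (fun x => rp (f x)) y).
have oE U (f : F -> sterm) y : p (SExt U f y) = o U (fun x => p (f x)) y.
  by apply/pP; apply: seqv_ext => x; apply/pP; rewrite rpK.
exists J, (fun x => p (SGen x)), o; split.
- split=> [x r y t Ex|U f r x y|U f x UUU fL Ux].
  + by rewrite -pZ -pD; apply/pP/seqv_gen.
  + by rewrite -pZ -pD; apply/pP/seqv_extL.
  + rewrite -[RHS]rpK; apply/pP/seqv_extE => // r y t Uy Ut.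
    by apply/pP; rewrite pD pZ !rpK fL.
- move=> Z g' o' gE' oL' oE'; pose ev := seval g' o'.
  have evP : forall s t, seqv s t -> ev s = ev t by apply: seval_eqv.
  have evp s t : p s = p t -> ev s = ev t by move/pP/evP.
  have hL : linear (fun x => ev (rp x)).
    move=> r x y; rewrite (_ : ev _ = ev (SAdd (SScale r (rp x)) (rp y))) //.
    by apply: evp; rewrite pD pZ !rpK.
  exists (mk_linear hL) => /=; split=> [x|U f y UUU].
    by apply: (evp _ (SGen x)); rewrite rpK.
  rewrite (evp _ (SExt U (fun x => rp (f x)) y)); last by rewrite rpK.
  by rewrite /ev /=; case: pselect.
- move=> V Vs Vg Vo x; have [t <-] := psurj x.
  elim: t => [y||s Vs' t Vt|t Vt|r t Vt|U f Vf y] //.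
  + by rewrite p0; apply: submod0.
  + by rewrite pD; apply: submodD.
  + suff -> : p (SOpp t) = - p t by apply: submodN.
    apply/eqP; rewrite -addr_eq0 -pD -p0; apply/eqP/pP/seqv_addN.
  + by rewrite pZ; apply: submodZ.
  + case: (pselect (UU U)) => [UUU|nU]; first by rewrite oE; apply: Vo.
    suff -> : p (SExt U f y) = 0 by apply: submod0.
    by rewrite -p0; apply/pP/seqv_ext0.
Qed.

End SkolemHull.

(** * Free modules and enough projectives *)

Section FreeModules.
Variable R : pzRingType.

(** For the empty family every operator term is identified with 0, so the hull without relations is
    the free module. *)
Lemma free_module (X : Type) : exists (F : lmodType R) (inc : X -> F),
  (forall (A : lmodType R) (a : X -> A), exists h : {linear F -> A}, forall x, h (inc x) = a x)
  /\ forall V, submod V -> (forall x, V (inc x)) -> forall z, V z.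
Proof.
have [F [inc [o [_ univ ind]]]] :=
  @skolem_hull R (GRing.regular R : lmodType R) (fun _ => False) X (fun _ _ _ _ => False).
exists F, inc; split=> [A a|V Vs Vg]; last exact: ind.
have [] // := univ A a (fun _ _ _ => 0).
  by move=> U f r x y; rewrite scaler0 addr0.
by move=> h [ha _]; exists h.
Qed.

Lemma free_projective (X : Type) (F : lmodType R) (inc : X -> F) :
  (forall (A : lmodType R) (a : X -> A), exists h : {linear F -> A}, forall x, h (inc x) = a x) ->
  (forall V, submod V -> (forall x, V (inc x)) -> forall z, V z) ->
  projective F.
Proof.
move=> univ ind A B g f gs.
have [a aP] := choice (fun x => gs (f (inc x))).
have [h hP] := univ A a; exists h => x.
have gfL : linear (fun x => g (h x) - f x).
  by move=> r y z; rewrite (linearP h) (linearP g) (linearP f) scalerBr opprD addrACA.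
apply/eqP; rewrite -subr_eq0; apply/eqP; move: x.
apply: ind; first exact: (submod_ker (mk_linear gfL)).
by move=> x /=; rewrite hP aP subrr.
Qed.

Lemma enough_projectives (M : lmodType R) :
  exists2 P : lmodType R, projective P & exists p : {linear P -> M}, surj_map p.
Proof.
have [F [inc [univ ind]]] := free_module M.
exists F; first exact: free_projective univ ind.
by have [p pP] := univ M id; exists p => y; exists (inc y).
Qed.

Lemma free_combination (X : Type) (F : lmodType R) (inc : X -> F) :
  (forall V, submod V -> (forall x, V (inc x)) -> forall z, V z) ->
  forall z, exists l : seq (R * X), z = \sum_(c <- l) c.1 *: inc c.2.
Proof.
apply; last by move=> x; exists [:: (1, x)]; rewrite big_seq1 scale1r.
split=> [|r _ _ [l ->] [l' ->]]; first by exists [::]; rewrite big_nil.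
exists ([seq (r * c.1, c.2) | c <- l] ++ l'); rewrite big_cat big_map scaler_sumr /=.
by congr (_ + _); apply: eq_bigr => c _; rewrite scalerA.
Qed.

End FreeModules.

(** * Orthogonality and Ext *)

Section Orthogonality.
Variable R : pzRingType.
Implicit Types (A B D E G K M N P Q S V W Z : lmodType R) (C Y : modclass R).

(** Surjectivity of Hom(Z, N) -> Hom(ker q, N). A map on the kernel is given as a function on all of
    Z, so that no kernel object is needed. *)
Definition ext_to Z M N (q : {linear Z -> M}) : Prop :=
  forall f : Z -> N, linear_on (fun z => q z = 0) f ->
    exists g : {linear Z -> N}, forall z, q z = 0 -> g z = f z.

(* Ext^1(M, N) = 0, in a form that quantifies over all epimorphisms onto M, not
   only projective ones; see [orth_of_proj] and [Ext1_orth]. *)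
Definition orth M N : Prop :=
  forall Z (q : {linear Z -> M}), surj_map q -> ext_to N q.

Lemma lin_addcomp A B D (h : {linear A -> D}) (g : {linear B -> D}) (f : {linear A -> B}) :
  exists k : {linear A -> D}, forall x, k x = h x + g (f x).
Proof. by apply: linear_map => r x y; rewrite !linearP scalerDr addrACA. Qed.

Lemma linear_on_linear M N (U : M -> Prop) (f : {linear M -> N}) : linear_on U f.
Proof. by move=> r x y _ _; rewrite linearP. Qed.

(** A lift [l] of p to Z makes every z a sum of some [l x] and some k in the kernel of q. Sending it
    to [g x + f k] is well defined because g agrees with f after l on the kernel of p. *)
Lemma orth_of_proj P M N (p : {linear P -> M}) :
  projective P -> surj_map p -> ext_to N p -> orth M N.
Proof.
move=> Pp ps pE Z q qs f fL.
have [l lP] := Pp _ _ q p qs.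
have flL : linear_on (fun x => p x = 0) (fun x => f (l x)).
  by move=> r x y px py; rewrite linearP fL ?lP.
have [g gP] := pE _ flL.
have [] := @linear_rel R Z N (fun z n => exists x k, [/\ q k = 0, z = l x + k & n = g x + f k]).
- move=> z; have [x px] := ps (q z); exists (g x + f (z - l x)), x, (z - l x).
  by rewrite linearB lP px subrr; split=> //; rewrite addrC subrK.
- move=> r _ _ _ _ [x [k [qk -> ->]]] [x' [k' [qk' -> ->]]].
  exists (r *: x + x'), (r *: k + k').
  split; first by rewrite linearP qk qk' scaler0 addr0.
    by rewrite linearP scalerDr addrACA.
  by rewrite linearP fL // scalerDr addrACA.
- move=> _ [x [k [qk + ->]]] => /eqP; rewrite eq_sym addr_eq0 => /eqP lx.
  have px : p x = 0 by rewrite -lP lx linearN qk oppr0.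
  rewrite gP // lx -scaleN1r (linear_onZ _ fL) ?linear0 //.
  by rewrite scaleN1r addNr.
move=> h hP; exists h => z qz.
have [x [k [qk zE ->]]] := hP z.
have px : p x = 0 by rewrite -lP; move: qz; rewrite zE linearD qk addr0.
by rewrite gP // zE (linear_onD fL) ?lP.
Qed.

Lemma projective_orth P N : projective P -> orth P N.
Proof.
move=> Pp; apply: (@orth_of_proj P P N (idfun : {linear P -> P})) => // [y|f fL].
  by exists y.
by exists (\0 : {linear P -> N}) => z /= ->; rewrite (linear_on0 _ fL).
Qed.

(** The inverse of i on the kernel of q extends to g on E, and z - i (g z) depends only on q z. *)
Lemma orth_split M N E (i : {linear N -> E}) (q : {linear E -> M}) :
  orth M N -> short_exact i q -> exists s : {linear M -> E}, forall x, q (s x) = x.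
Proof.
move=> oMN [iI iq qs].
have /choice [f fP] : forall z, exists n, q z = 0 -> i n = z.
  move=> z; by have [/iq [n <-]|nq] := pselect (q z = 0); [exists n|exists 0].
have fL : linear_on (fun z => q z = 0) f.
  move=> r x y qx qy; apply: iI; rewrite linearP !fP //.
  by rewrite linearP qx qy scaler0 addr0.
have [g gP] := oMN _ _ qs _ fL.
have [] := @linear_rel R M E (fun m e => exists2 z, q z = m & e = z - i (g z)).
- by move=> m; have [z qz] := qs m; exists (z - i (g z)), z.
- move=> r _ _ _ _ [x <- ->] [y <- ->]; exists (r *: x + y); first by rewrite linearP.
  by rewrite (linearP g) (linearP i) scalerBr opprD addrACA.
- by move=> _ [z qz ->]; rewrite gP // fP // subrr.
move=> s sP; exists s => m; have [z qz ->] := sP m.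
by rewrite linearB qz [q (i _)](iq _).2 ?subr0 //; exists (g z).
Qed.

(** Pulling p back along f gives an extension of A by K. It splits, and the section followed by the
    projection to P is the lift. *)
Lemma orth_lift A K P W (i : {linear K -> P}) (p : {linear P -> W}) :
  orth A K -> short_exact i p ->
  forall f : {linear A -> W}, exists g : {linear A -> P}, forall x, p (g x) = f x.
Proof.
move=> oAK [iI ip ps] f.
have [Z [u [v [uv uvE uv0]]]] := pullback f p.
have [] := @linear_rel R K Z (fun k w => u w = 0 /\ v w = i k).
- move=> k; have [|w uw vw] := uvE 0 (i k); last by exists w.
  by rewrite linear0; apply/esym/ip; exists k.
- by move=> r x x' y y' [py qy] [py' qy']; rewrite !linearP py qy py' qy' scaler0 addr0.
- by move=> w [uw vw]; apply: uv0; rewrite // vw linear0.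
move=> j jP; have [|s sP] := @orth_split A K Z j u oAK.
  split.
  - by apply/injP => a ia; have [_ +] := jP a; rewrite ia linear0 => /esym; apply: inj0.
  - move=> w; split=> [uw|[k <-]]; last by have [] := jP k.
    have [|k ik] := (ip (v w)).1; first by rewrite -uv uw linear0.
    exists k; apply/eqP; rewrite -subr_eq0; apply/eqP; have [uj vj] := jP k.
    by apply: uv0; rewrite linearB ?uj ?vj ?uw ?ik subrr.
  - by move=> y; have [x px] := ps (f y); have [w uw _] := uvE _ _ (esym px); exists w.
by exists (v \o s) => x /=; rewrite -uv sP.
Qed.

(** The map is extended in two stages: from the kernel of q to that of b after q, which maps onto A,
    and from there to Z. *)
Lemma orth_extl A B D N : ses A B D -> orth A N -> orth D N -> orth B N.
Proof.
move=> [a [b [aI ab bs]]] oA oD Z q qs f fL.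
have [S [i [iI iP]]] := sub_module (submod_ker (b \o q)).
have [] := @linear_rel R S A (fun s x => a x = q (i s)).
- by move=> s; apply/ab/(iP (i s)); exists s.
- by move=> r x x' y y'; rewrite !linearP => -> ->.
- by move=> y; rewrite !linear0; apply: inj0.
move=> t tP; have [] := oA _ t _ (fun s => f (i s)).
- move=> x; have [z qz] := qs (a x).
  have [|s isz] := (iP z).1; first by rewrite /= qz; apply/ab; exists x.
  by exists s; apply: aI; rewrite tP isz.
- by move=> r x y tx ty; rewrite linearP fL // -tP ?tx ?ty linear0.
move=> g gP; have [] := oD _ (b \o q) _ (fun z => xget 0 (fun n => exists2 s, i s = z & n = g s)).
- by move=> d; have [y <-] := bs d; have [z <-] := qs y; exists z.
- have E s : xget 0 (fun n => exists2 s', i s' = i s & n = g s') = g s.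
    by apply: xget_unique => [|n [s' /iI -> ->]]; first by exists s.
  by move=> r _ _ /iP [s <-] /iP [s' <-]; rewrite -linearP !E linearP.
move=> h hP; exists h => z qz; have bqz : b (q z) = 0 by rewrite qz linear0.
rewrite hP //; apply: xget_unique => [|n [s' is' ->]]; first last.
  by rewrite gP -?is' //; apply: aI; rewrite tP is' qz linear0.
have /iP [s isz] := bqz; exists s => //.
by rewrite gP -?isz //; apply: aI; rewrite tP isz qz linear0.
Qed.

(** The pullback of q along r is an epimorphism onto M, and Z maps into it by z |-> (i (q z), z). *)
Lemma orth_retractl A M N (i : {linear A -> M}) (r : {linear M -> A}) :
  (forall x, r (i x) = x) -> orth M N -> orth A N.
Proof.
move=> ri oM Z q qs f fL.
have [W [u [v [uv uvE uv0]]]] := pullback r q.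
have [] := oM _ u _ (fun w => f (v w)).
- by move=> y; have [z qz] := qs (r y); have [w uw _] := uvE _ _ (esym qz); exists w.
- by move=> c x y ux uy; rewrite linearP fL // -uv ?ux ?uy linear0.
move=> g gP.
have [] := @linear_rel R Z W (fun z w => u w = i (q z) /\ v w = z).
- by move=> z; have [|w] := uvE (i (q z)) z; [rewrite ri|exists w].
- by move=> c x x' y y' [uy vy] [uy' vy']; rewrite !linearP uy vy uy' vy'.
- by move=> w [uw vw]; apply: uv0; rewrite // uw !linear0.
move=> h hP; exists (g \o h) => z qz /=; have [uh vh] := hP z.
by rewrite gP ?vh // uh qz linear0.
Qed.

Lemma orth_retractr M A N (i : {linear A -> N}) (r : {linear N -> A}) :
  (forall x, r (i x) = x) -> orth M N -> orth M A.
Proof.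
move=> ri oM Z q qs f fL.
have [|g gP] := oM _ q qs (fun z => i (f z)).
  by move=> c x y qx qy; rewrite fL // linearP.
by exists (r \o g) => z qz /=; rewrite gP.
Qed.

(** The composite of f with b extends to P and lifts to h : P -> B; on the kernel of p the
    difference f - h has values in A, where it is extended. *)
Lemma orth_extr M A B D : ses A B D -> orth M A -> orth M D -> orth M B.
Proof.
move=> [a [b [aI ab bs]]] oA oD.
have [P Pp [p ps]] := enough_projectives M.
apply: (orth_of_proj Pp ps) => f fL.
have [|g gP] := oD _ p ps (fun z => b (f z)).
  by move=> c x y qx qy; rewrite fL // linearP.
have [h hP] := Pp _ _ b g bs.
have /choice [k kP] : forall z, exists n, p z = 0 -> a n = f z - h z.
  move=> z; have [pz|npz] := pselect (p z = 0); last by exists 0.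
  by have /ab [n <-] : b (f z - h z) = 0; [rewrite linearB hP gP // subrr|exists n].
have [|l lP] := oA _ p ps k.
  move=> c x y px py; apply: aI; rewrite linearP !kP //; last first.
    by rewrite linearP px py scaler0 addr0.
  by rewrite fL // linearP scalerBr opprD addrACA.
have [m mP] := lin_addcomp h a l.
by exists m => z pz; rewrite mP lP // kP // addrC subrK.
Qed.

Lemma projectiveP P : projective P <-> forall N, orth P N.
Proof.
split=> [Pp N|oP]; first exact: projective_orth.
move=> A B g f gs; have [K [i se]] := ses_of_surj gs.
exact: orth_lift (oP K) se f.
Qed.

(** * Projective resolutions and the comparison of Ext with orthogonality *)

Section Splice.
Variables (K P M : lmodType R) (T : left_resolution K).
Variables (i : {linear K -> P}) (p : {linear P -> M}).
Hypothesis ip : short_exact i p.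

Definition splice_obj (n : nat) : lmodType R := if n is k.+1 then T k else P.
Definition splice_diff (n : nat) : {linear splice_obj n.+1 -> splice_obj n} :=
  match n return {linear splice_obj n.+1 -> splice_obj n} with
  | 0 => i \o res_aug T
  | k.+1 => res_diff T k
  end.

Lemma splice_exact0 : exact_at (splice_diff 0%N) p.
Proof.
case: ip => iI ipe ps y; split=> [/ipe [k <-]|[x <-]].
  by have [x <-] := @res_aug_surj _ _ T k; exists x.
by apply/ipe; exists (res_aug T x).
Qed.

Lemma splice_exactS n : exact_at (splice_diff n.+1) (splice_diff n).
Proof.
case: n => [|n]; last exact: res_exactS.
move=> y; case: ip => iI _ _; split=> [/= /(inj0 iI) /(@res_exact0 _ _ T) //|].
by move=> /(@res_exact0 _ _ T) /= ->; rewrite linear0.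
Qed.

Definition splice : left_resolution M :=
  @LeftResolution R M splice_obj splice_diff p (let: And3 _ _ ps := ip in ps)
    splice_exact0 splice_exactS.

End Splice.

Lemma projective_resolution_exists M :
  exists T : left_resolution M, projective_resolution T.
Proof.
pose Syz M := {K : lmodType R & {P : lmodType R & ({linear K -> P} * {linear P -> M})%type}}.
have syzP M' : exists S : Syz M',
    projective (projT1 (projT2 S)) /\ short_exact (projT2 (projT2 S)).1 (projT2 (projT2 S)).2.
  have [P Pp [p ps]] := enough_projectives M'.
  have [K [i se]] := ses_of_surj ps.
  by exists (existT _ K (existT _ P (i, p))).
pose S M' : Syz M' := sval (cid (syzP M')).
have SP M' := svalP (cid (syzP M')); rewrite -/(S _) in SP.
(* Iterating one fixed choice of syzygy gives all terms at once: [T n] covers [K n] with kernel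
   [K n.+1]. *)
pose K n := iter n (fun M' => projT1 (S M')) M.
pose T n := projT1 (projT2 (S (K n))).
pose i n : {linear K n.+1 -> T n} := (projT2 (projT2 (S (K n)))).1.
pose p n : {linear T n -> K n} := (projT2 (projT2 (S (K n)))).2.
have ip n : short_exact (i n) (p n) := (SP (K n)).2.
pose d n : {linear T n.+1 -> T n} := i n \o p n.+1.
have ex0 : exact_at (d 0%N) (p 0%N).
  have [_ ip0 _] := ip 0%N; have [_ _ ps] := ip 1%N.
  move=> y; split=> [/ip0 [k <-]|[x <-]]; last by apply/ip0; exists (p 1%N x).
  by have [x <-] := ps k; exists x.
have exS n : exact_at (d n.+1) (d n).
  have [iI _ _] := ip n; have [_ ipn _] := ip n.+1; have [_ _ ps] := ip n.+2.
  move=> y; split=> [/= /(inj0 iI) /ipn [k <-]|[x <-]].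
    by have [x <-] := ps k; exists x.
  by rewrite /= (ipn _).2 ?linear0 //; exists (p n.+2 x).
have aug_surj : surj_map (p 0%N) by have [] := ip 0%N.
exists (@LeftResolution R M T d (p 0%N) aug_surj ex0 exS) => n.
exact: (SP (K n)).1.
Qed.

(** A cocycle on T_1 factors through the image of T_1 -> T_0, which is the kernel of the
    augmentation; it is a coboundary exactly when the factor extends to T_0. *)
Lemma Ext1_orth M N : Ext_vanishes 1 M N <-> orth M N.
Proof.
split=> [[T Tp TP]|oMN].
  apply: (orth_of_proj (Tp 0%N) (@res_aug_surj _ _ T)) => f fL.
  have dL : linear (fun x => f (res_diff T 0%N x)).
    by move=> r x y; rewrite linearP fL //; apply/(@res_exact0 _ _ T); [exists x|exists y].
  have [|g gP] := TP (mk_linear dL).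
    move=> x; rewrite /= (_ : res_diff T 0%N _ = 0) ?(linear_on0 _ fL) ?linear0 //.
    by apply/(@res_exactS _ _ T); exists x.
  by exists g => z /(@res_exact0 _ _ T) [x <-]; rewrite -gP.
have [T Tp] := projective_resolution_exists M; exists T => // f fc.
have fd x y : res_diff T 0%N x = res_diff T 0%N y -> f x = f y.
  move=> dxy; apply/eqP; rewrite -subr_eq0 -linearB; apply/eqP.
  have /(@res_exactS _ _ T) [z <-] : res_diff T 0%N (x - y) = 0 by rewrite linearB dxy subrr.
  exact: fc.
pose F z := xget 0 (fun n => exists2 x, res_diff T 0%N x = z & n = f x).
have FE x : F (res_diff T 0%N x) = f x.
  by apply: xget_unique => [|n [s' /fd -> ->]]; first by exists x.
have [|g gP] := oMN _ (res_aug T) (@res_aug_surj _ _ T) F.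
  move=> r _ _ /(@res_exact0 _ _ T) [s <-] /(@res_exact0 _ _ T) [s' <-].
  by rewrite -linearP !FE linearP.
by exists g => x; rewrite gP ?FE //; apply/(@res_exact0 _ _ T); exists x.
Qed.

(** Splicing P onto a resolution of K shifts the complex by one degree. Degree 0 is left out,
    because there only the zero map is a coboundary. *)
Lemma Ext_shift n K P M N : ses K P M -> projective P ->
  Ext_vanishes n.+1 K N -> Ext_vanishes n.+2 M N.
Proof.
move=> [i [p ip]] Pp [T Tp TP]; exists (splice T ip) => [[|k] //|f]; first exact: Tp.
exact: TP.
Qed.

End Orthogonality.

(** * Resolving classes and relative dimension *)

Section Resolving.
Variable R : pzRingType.
Implicit Types (A B D E G K M N P Q S V W Z : lmodType R) (C Y : modclass R).

Lemma orth_retraction M N E (i : {linear N -> E}) (q : {linear E -> M}) :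
  orth M N -> short_exact i q -> exists r : {linear E -> N}, forall x, r (i x) = x.
Proof.
move=> oMN [iI iq qs].
pose f z := xget 0 (fun n => i n = z).
have fE n : f (i n) = n by apply: xget_unique => // n' /iI.
have [|g gP] := oMN _ _ qs f.
  by move=> r _ _ /iq [s <-] /iq [s' <-]; rewrite -linearP !fE.
by exists g => x; rewrite gP ?fE //; apply/iq; exists x.
Qed.

(** Closure under kernels of epimorphisms is asked only for syzygies; the general case follows by
    [ses_kernel]. *)
Record resolving C : Prop := Resolving {
  rsv_proj : forall P, projective P -> C P;
  rsv_ext : forall A B D, ses A B D -> C A -> C D -> C B;
  rsv_retract : forall A B (i : {linear A -> B}) (r : {linear B -> A}),
    (forall x, r (i x) = x) -> C B -> C A;
  rsv_syz : forall K P M, ses K P M -> projective P -> C M -> C K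
}.

(** The pullback of B and P over D is an extension of B by K, hence in C, and it has A as a retract
    since P is projective. Only two closure properties are assumed, so that C may also be the class
    of all M with [orth M N]. *)
Lemma ses_kernel C :
    (forall A B D, ses A B D -> C A -> C D -> C B) ->
    (forall A B (i : {linear A -> B}) (r : {linear B -> A}),
       (forall x, r (i x) = x) -> C B -> C A) ->
  forall A B D K P, ses A B D -> ses K P D -> projective P -> C B -> C K -> C A.
Proof.
move=> Cext Cretr A B D K P sA sK Pp CB CK.
have [Z [i [q se]] sZ] := pullback_ses sA sK.
have [r ri] := orth_retraction (projective_orth (N := A) Pp) se.
by apply: Cretr ri _; apply: Cext sZ CK CB.
Qed.

Lemma zero_module_exists : exists Z, zero_module Z.
Proof.
have [|Z [p [ps pP]]] := @quot_module R (GRing.regular R : lmodType R) (fun _ => True).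
  by [].
by exists Z => z; have [x <-] := ps z; apply/pP.
Qed.

Lemma zero_module_projective Z : zero_module Z -> projective Z.
Proof.
move=> Z0 A B g f gs; exists \0 => x /=.
by rewrite (Z0 x) !linear0.
Qed.

Lemma syzygy_exists M : exists K P, ses K P M /\ projective P.
Proof.
have [P Pp [p ps]] := enough_projectives M.
by have [K [i se]] := ses_of_surj ps; exists K, P; split=> //; exists i, p.
Qed.

Definition syz_class C : modclass R := fun M =>
  exists K P, [/\ ses K P M, projective P & C K].

(** Independence of the chosen syzygy, a form of Schanuel's lemma. *)
Lemma syz_class_any C K P M : resolving C ->
  ses K P M -> projective P -> syz_class C M -> C K.
Proof.
move=> rC sK Pp [K' [P' [sK' Pp' CK']]].
by apply: (ses_kernel (rsv_ext rC) (rsv_retract rC) sK sK' Pp') => //; apply: rsv_proj.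
Qed.

Lemma sub_syz_class C M : resolving C -> C M -> syz_class C M.
Proof.
move=> rC CM; have [K [P [sK Pp]]] := syzygy_exists M.
by exists K, P; split=> //; apply: rsv_syz sK Pp CM.
Qed.

Lemma syz_class_resolving C : resolving C -> resolving (syz_class C).
Proof.
move=> rC; split.
- by move=> P Pp; apply: sub_syz_class => //; apply: rsv_proj.
- move=> A B D sB cA cD.
  have [K [P [sK Pp]]] := syzygy_exists B; exists K, P; split=> //.
  (* Z is a syzygy of D and maps onto A with kernel K, so K is reached as a kernel. *)
  have [Z sZ sZ'] := ses_surj_comp sK sB.
  have CZ := syz_class_any rC sZ Pp cD.
  have [KA [PA [sKA PAp CKA]]] := cA.
  exact: (ses_kernel (rsv_ext rC) (rsv_retract rC) sZ' sKA PAp).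
- (* With M a retract of A and P -> M, Q -> A epimorphisms, the map
     (x, y) |-> i p x + (1 - i r) q y from P * Q onto A has kernel
     K + ker ((1 - i r) q). *)
  move=> M A i r ri cA.
  have [P Pp [p ps]] := enough_projectives M.
  have [K [j se]] := ses_of_surj ps; exists K, P; split=> //; first by exists j, p.
  have [Q Qp [q qs]] := enough_projectives A.
  have uL : linear (fun x : P * Q => i (p x.1) + (q x.2 - i (r (q x.2)))).
    move=> c [x1 x2] [y1 y2] /=.
    rewrite (linearP p) (linearP q) (linearP r) !(linearP i).
    by rewrite opprD (addrACA (c *: q x2)) -scalerBr addrACA -scalerDr.
  have us : surj_map (mk_linear uL).
    move=> a; have [x px] := ps (r a); have [y qy] := qs a; exists (x, y) => /=.
    by rewrite px qy addrC subrK.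
  have u0 x y : mk_linear uL (x, y) = 0 -> p x = 0.
    by move=> /(congr1 r); rewrite /= !linearD linearN !ri subrr addr0 linear0.
  have [Z [k [kI ku _]]] := ses_of_surj us.
  have PQp : projective (P * Q)%type.
    move=> X Y g f gs.
    have f1L : linear (fun x : P => f (x, 0)).
      by move=> c x y; rewrite -linearP; congr (f (_, _)); rewrite /= scaler0 addr0.
    have f2L : linear (fun x : Q => f (0, x)).
      by move=> c x y; rewrite -linearP; congr (f (_, _)); rewrite /= scaler0 addr0.
    have [h1 h1P] := Pp _ _ g (mk_linear f1L) gs.
    have [h2 h2P] := Qp _ _ g (mk_linear f2L) gs.
    have hL : linear (fun x : P * Q => h1 x.1 + h2 x.2).
      by move=> c x y; rewrite !linearP /= scalerDr addrACA.
    exists (mk_linear hL) => x /=; rewrite linearD h1P h2P /= -linearD.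
    by congr (f _); case: x => a b; congr (_, _); rewrite /= ?addr0 ?add0r.
  have CZ : C Z.
    apply: (syz_class_any rC _ PQp cA); exists k, (mk_linear uL); split=> //.
  case: se => jI jp _.
  have [] := @linear_rel R K Z (fun a z => k z = (j a, 0)).
  + move=> a; apply/ku => /=; rewrite (jp _).2; last by exists a.
    by rewrite !linear0 !addr0.
  + move=> c x x' y y' ky ky'; rewrite !linearP ky ky'.
    by congr (_, _); rewrite /= scaler0 addr0.
  + by move=> z; rewrite linear0; apply: inj0.
  move=> s sP.
  have [] := @linear_rel R Z K (fun z a => j a = (k z).1).
  + move=> z; apply/jp; apply: (u0 _ (k z).2); rewrite -surjective_pairing.
    by apply/ku; exists z.
  + by move=> c x x' y y' ky ky'; rewrite !linearP ky ky'.
  + by move=> z; rewrite linear0; apply: inj0.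
  move=> t tP; apply: (rsv_retract rC (i := s) (r := t)) CZ => x.
  by apply: jI; rewrite tP sP.
- move=> K P M sK Pp cM; apply: sub_syz_class => //.
  exact: syz_class_any sK Pp cM.
Qed.

(** Resolution dimension by iterated syzygies, which suits induction; for resolving C it agrees with
    [wedge] by [wedgeP]. *)
Fixpoint pdim_le C n : modclass R := if n is k.+1 then syz_class (pdim_le C k) else C.

Lemma pdim_le_resolving C n : resolving C -> resolving (pdim_le C n).
Proof. by move=> rC; elim: n => //= n; apply: syz_class_resolving. Qed.

Lemma pdim_le_mono C m n M : resolving C -> (m <= n)%N -> pdim_le C m M -> pdim_le C n M.
Proof.
move=> rC; elim: n => [|n IH]; first by rewrite leqn0 => /eqP ->.
rewrite leq_eqVlt => /predU1P [->//|/IH {}IH /IH pM].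
by apply: sub_syz_class pM; apply: pdim_le_resolving.
Qed.

Lemma pdim_le_sub C C' n M : (forall M, C M -> C' M) -> pdim_le C n M -> pdim_le C' n M.
Proof.
move=> CC'; elim: n M => [|n IH] M //=; first exact: CC'.
by move=> [K [P [sK Pp /IH pK]]]; exists K, P.
Qed.

(** For a projective P covering B with kernel L, the kernel Z of P -> B -> M is an extension of K by
    L, and L lies in C. *)
Lemma pdim_le_ses C n K B M : resolving C ->
  ses K B M -> C B -> pdim_le C n K -> pdim_le C n.+1 M.
Proof.
move=> rC sM CB pK; have [L [P [sL Pp]]] := syzygy_exists B.
have [Z sZ sZ'] := ses_surj_comp sL sM.
exists Z, P; split=> //; apply: (rsv_ext (pdim_le_resolving n rC) sZ') => //.
by apply: (@pdim_le_mono C 0) => //; apply: rsv_syz sL Pp CB.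
Qed.

Lemma pdim_le_resolution C n M : resolving C -> pdim_le C n M <->
  exists T : left_resolution M,
    (forall i, (i <= n)%N -> C (T i)) /\ forall i, (n < i)%N -> zero_module (T i).
Proof.
move=> rC; elim: n M => [|n IH] M; split.
- move=> /= CM; have [Z Z0] := zero_module_exists.
  pose T n : lmodType R := if n is 0 then M else Z.
  pose d n : {linear T n.+1 -> T n} := \0.
  have e0 : exact_at (d 0%N) (idfun : {linear M -> M}).
    by move=> y; split=> [/= ->|[x <-] //]; exists 0.
  have eS i : exact_at (d i.+1) (d i).
    by move=> y; split=> // _; exists 0; rewrite linear0 (Z0 y).
  have idS : surj_map (idfun : {linear M -> M}) by move=> y; exists y.
  exists (@LeftResolution R M T d _ idS e0 eS); split=> [i|[|i] //].
  by rewrite leqn0 => /eqP ->.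
- move=> [T [TC T0]].
  have [] := @linear_rel R M (T 0%N) (fun x t => res_aug T t = x).
  + exact: res_aug_surj.
  + by move=> r x x' y y' <- <-; rewrite linearP.
  + by move=> y /(@res_exact0 _ _ T) [x <-]; rewrite (T0 1%N isT x) linear0.
  by move=> s sP; apply: (rsv_retract rC (i := s) (r := res_aug T)) => //; apply: TC.
- move=> [K [P [[i [p ip]] Pp /IH [T [TC T0]]]]].
  exists (splice T ip); split=> [[|k] //|[|k] //]; last exact: T0.
    by move=> _; apply: rsv_proj.
  exact: TC.
- move=> [T [TC T0]].
  have [K [i ip]] := ses_of_surj (@res_aug_surj _ _ T).
  apply: (@pdim_le_ses C n K (T 0%N)) => //; [by exists i, (res_aug T)|exact: TC|].
  case: ip => iI ip _; apply/IH.
  have [] := @linear_rel R (T 1%N) K (fun x k => i k = res_diff T 0%N x).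
  + by move=> x; apply/ip/(@res_exact0 _ _ T); exists x.
  + by move=> r x x' y y'; rewrite !linearP => -> ->.
  + by move=> y; rewrite !linear0; apply: inj0.
  move=> q qP.
  have qs : surj_map q.
    move=> k; have /(@res_exact0 _ _ T) [x dx] : res_aug T (i k) = 0 by apply/ip; exists k.
    by exists x; apply: iI; rewrite qP.
  have e0 : exact_at (res_diff T 1%N) q.
    move=> y; split=> [qy|[x dx]].
      by apply/(@res_exactS _ _ T); rewrite -qP qy linear0.
    by apply: (inj0 iI); rewrite qP; apply/(@res_exactS _ _ T); exists x.
  exists (@LeftResolution R K (fun n => T n.+1) (fun n => res_diff T n.+1) q qs e0
            (fun n => @res_exactS _ _ T n.+1)); split=> k kn; [exact: TC|exact: T0].
Qed.

Lemma wedgeP C n M : resolving C -> wedge C n M <-> pdim_le C n M.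
Proof.
move=> rC; split=> [[T [k [kn TC T0]]]|/(pdim_le_resolution _ _ rC) [T [TC T0]]].
  by apply: (pdim_le_mono rC kn); apply/(pdim_le_resolution _ _ rC); exists T.
by exists T, n.
Qed.

Lemma resolving_projective : resolving (@projective R).
Proof.
have pE A B D : ses A B D -> projective A -> projective D -> projective B.
  by move=> s /projectiveP pA /projectiveP pD; apply/projectiveP => N; apply: orth_extl s _ _.
have pR A B (i : {linear A -> B}) (r : {linear B -> A}) :
    (forall x, r (i x) = x) -> projective B -> projective A.
  by move=> ri /projectiveP pB; apply/projectiveP => N; apply: orth_retractl ri _.
split=> // K P M [i [p ip]] Pp Mp.
have [r ri] := orth_retraction (projective_orth (N := K) Mp) ip.
exact: pR ri Pp.
Qed.

End Resolving.

(** * Enough injectives *)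

(* Additive maps into Q/Z are represented by maps into rat that are additive up
   to integers. *)
Section RationalsModIntegers.
Import Order.TTheory Num.Theory.

Lemma int_eq (a b : rat) : a = b -> a \is a Num.int -> b \is a Num.int.
Proof. by move=> ->. Qed.

(** Division with remainder by the least positive element, or m = 0 if there is none. *)
Lemma int_subgroup (K : int -> Prop) : K 0 -> (forall a b, K a -> K b -> K (a - b)) ->
  exists m : nat, K m%:Z /\ forall k, K k -> exists q, k = q * m%:Z.
Proof.
move=> K0 KB.
have KN a : K a -> K (- a) by rewrite -sub0r; apply: KB.
have KM q a : K a -> K (q * a).
  move=> Ka; have KMn (n : nat) : K (n%:Z * a).
    elim: n => [|n IH]; first by rewrite mul0r.
    by rewrite intS mulrDl mul1r -[n%:Z * a]opprK; apply: KB => //; apply: KN.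
  by case: q => n; rewrite ?NegzE ?mulNr //; apply: KN.
case: (pselect (exists n : nat, (0 < n)%N && `[< K n%:Z >])) => [exK|nK].
  case: (ex_minnP exK) => m /andP [m0 /asboolP Km] mmin.
  exists m; split=> // k Kk; exists (k %/ m)%Z.
  have r0 : (k %% m)%Z >= 0 by rewrite modz_ge0 // eqz_nat -lt0n.
  have rm : (k %% m)%Z < m by apply: ltz_pmod; rewrite ltz_nat.
  have Kr : K (k %% m)%Z by rewrite /modz; apply: KB => //; apply: KM.
  case E : (k %% m)%Z r0 rm Kr => [r|//] _ rm Kr.
  have [r0|r0] := posnP r; first by rewrite {1}(divz_eq k m) E r0 addr0.
  have := mmin r; rewrite r0 /= => /(_ (asboolT Kr)).
  by rewrite leqNgt -ltz_nat rm.
exists 0%N; split=> // k Kk; exists 0; rewrite mul0r.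
apply: contrapT => k0; apply: nK.
exists `|k|%N; rewrite absz_gt0; apply/andP; split; first by apply/eqP.
apply/asboolP; case: (intP k) Kk {k0} => [||n] // /KN.
by rewrite opprK.
Qed.

Definition subgroup (B : zmodType) (G : B -> Prop) :=
  G 0 /\ forall x y, G x -> G y -> G (x - y).

Lemma subgroupMz (B : zmodType) (G : B -> Prop) : subgroup G ->
  forall x (k : int), G x -> G (x *~ k).
Proof.
move=> [G0 GB] x k Gx.
have GN y : G y -> G (- y) by rewrite -sub0r; apply: GB.
have GM (n : nat) : G (x *+ n).
  by elim: n => [//|n IH]; rewrite mulrS -[x *+ n]opprK; apply: GB => //; apply: GN.
by case: k => n; [apply: GM|rewrite NegzE mulrNz; apply: GN; apply: GM].
Qed.

(** Divisibility of Q/Z: [G0] is the graph of a partial homomorphism from B to Q/Z, and a maximal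
    graph containing it is defined everywhere. *)
Lemma rat_extension (B : zmodType) (G0 : B * rat -> Prop) :
    subgroup G0 -> (forall d, G0 (0, d) -> d \is a Num.int) ->
  exists h : B -> rat, (forall x y, h (x + y) - (h x + h y) \is a Num.int) /\
    forall b d, G0 (b, d) -> h b - d \is a Num.int.
Proof.
move=> G0s G0f.
pose good (G : set (B * rat)) :=
  [/\ subgroup G, forall d, G (0, d) -> d \is a Num.int & (G0 `<=` G)%classic].
have [||G [[Gs Gf G0G] Gmax]] := @Zorn_set (B * rat)%type good G0.
- by split.
- move=> F [A FA] Fgood Ftot; split.
  + split; first by exists A => //; have [[]] := Fgood _ FA.
    move=> x y [A1 F1 A1x] [A2 F2 A2y].
    have [A12|A21] := Ftot _ _ F1 F2.
    * by exists A2 => //; have [[_ AB] _ _] := Fgood _ F2; apply: AB => //; apply: A12.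
    * by exists A1 => //; have [[_ AB] _ _] := Fgood _ F1; apply: AB => //; apply: A21.
  + by move=> d [A1 /Fgood [_ A1f _]]; apply: A1f.
  + by move=> x G0x; exists A => //; have [_ _] := Fgood _ FA; apply.
have GB x y d e : G (x, d) -> G (y, e) -> G (x - y, d - e) by move=> Gx; apply: (Gs.2 _ _ Gx).
have GM x d k : G (x, d) -> G (x *~ k, d *~ k).
  move=> /(subgroupMz Gs k); congr (G _); rewrite [LHS]surjective_pairing.
  by rewrite (raddfMz (fst : B * rat -> B)) (raddfMz (snd : B * rat -> rat)).
have GT b : exists d, G (b, d).
  have [||m [[e0 Ge0] mP]] := @int_subgroup (fun k => exists e, G (b *~ k, e)).
  - by exists 0; rewrite mulr0z; exact: Gs.1.
  - by move=> k l [e Ge] [f Gf']; exists (e - f); rewrite mulrzBr; apply: GB.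
  (* The multiples of b in the domain are those by multiples of m, so an m-th part of the value [e0]
     at m b serves at b. For m = 0 the quotient is 0, a valid choice because then no nonzero
     multiple of b is in the domain. *)
  pose d := e0 / m%:R.
  have dP k e : G (b *~ k, e) -> d *~ k - e \is a Num.int.
    move=> Gk; have [|q kE] := mP k; first by exists e.
    have : G (0, e0 *~ q - e).
      have := GB _ _ _ _ (GM _ _ q Ge0) Gk.
      by rewrite kE -mulrzA mulrC subrr.
    move/Gf; rewrite kE /d; case: (posnP m) => [m0|m0].
      rewrite m0 in Ge0 *; rewrite mulr0 mulr0z sub0r rpredN => i1.
      have i2 : e0 *~ q \is a Num.int by apply: rpredMz; apply: Gf; rewrite mulr0z in Ge0.
      by rewrite -(subKr (e0 *~ q) e) rpredB.
    suff -> : e0 / m%:R *~ (q * m%:Z) = e0 *~ q by [].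
    rewrite [q * _]mulrC mulrzA -pmulrn -(mulr_natr (e0 / m%:R)) divfK //.
    by rewrite pnatr_eq0 -lt0n.
  pose G' (p : B * rat) := exists x y k, [/\ G (x, y), p.1 = x + b *~ k & p.2 = y + d *~ k].
  exists d; apply: (Gmax G'); first by move=> [x y] Gx; exists x, y, 0; rewrite !mulr0z !addr0.
  - split.
    + split; first by exists 0, 0, 0; rewrite !mulr0z !addr0; split=> //; exact: Gs.1.
      move=> [_ _] [_ _] [x [y [k [Gx /= -> ->]]]] [x' [y' [k' [Gx' /= -> ->]]]].
      exists (x - x'), (y - y'), (k - k'); split; first exact: GB.
        by rewrite /= opprD addrACA mulrzBr.
      by rewrite /= opprD addrACA mulrzBr.
    + move=> e [x [y [k [Gx /= xk ->]]]].
      have : G (b *~ k, - y).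
        have := GB _ _ _ _ Gs.1 Gx; rewrite !sub0r; congr (G (_, _)).
        by apply/eqP; rewrite eq_sym -addr_eq0 addrC -xk.
      by move=> /dP; rewrite opprK addrC.
    + by move=> [x y] /G0G Gx; exists x, y, 0; rewrite !mulr0z !addr0.
  - by exists 0, 0, 1; rewrite !mulr1z !add0r; split=> //; exact: Gs.1.
have [h hP] := choice GT; exists h; split=> [x y|b d Gbd].
  apply: Gf; have := GB _ _ _ _ (GB _ _ _ _ (hP (x + y)) (hP x)) (hP y).
  by rewrite opprD addrA (addrC x) addrK subrr.
by apply: Gf; rewrite -(subrr b); apply: GB => //; apply: G0G.
Qed.

(** On the subgroup generated by n the map n |-> 1/c is used, where c is the order of n, or 2 if the
    order is infinite. *)
Lemma rat_separation (B : zmodType) (n : B) : n != 0 ->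
  exists h : B -> rat, (forall x y, h (x + y) - (h x + h y) \is a Num.int) /\
    h n \isn't a Num.int.
Proof.
move=> n0.
have [||m [nm mP]] := @int_subgroup (fun k => n *~ k = 0); first by rewrite mulr0z.
  by move=> a b na nb; rewrite mulrzBr na nb subrr.
pose c := if m == 0%N then 2%N else m; pose d : rat := c%:R^-1.
have c1 : (1 < c)%N.
  rewrite /c; case: eqP => // /eqP m0; rewrite ltn_neqAle lt0n m0 andbT eq_sym.
  by apply: contra n0 => /eqP m1; rewrite -[n]mulr1z -nm m1.
have dN : d \isn't a Num.int.
  apply/negP => /intrP [z dz].
  have : 0 < d < 1 by rewrite invr_gt0 ltr0n invf_lt1 ?ltr1n ?ltr0n ltnW.
  by rewrite dz ltr0z ltrz1; case: z {dz} => // -[].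
have dk k : n *~ k = 0 -> d *~ k \is a Num.int.
  move=> /mP [q ->]; rewrite /d /c; case: eqP => [->|/eqP m0].
    by rewrite mulr0 mulr0z rpred0.
  by rewrite [q * _]mulrC mulrzA -pmulrn -(mulr_natr m%:R^-1) mulVf ?pnatr_eq0 // rpredMz // rpred1.
pose G0 (p : B * rat) := exists k : int, p = (n *~ k, d *~ k).
have [||h [hD hP]] := @rat_extension B G0.
- split; first by exists 0; rewrite !mulr0z.
  by move=> _ _ [k ->] [l ->]; exists (k - l); rewrite !mulrzBr.
- by move=> e [k [/esym nk ->]]; apply: dk.
exists h; split=> //; apply: contra dN => hn.
rewrite -(subKr (h n) d); apply: rpredB => //.
by apply: hP; exists 1.
Qed.

End RationalsModIntegers.

Section Injectives.
Variable R : pzRingType.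
Implicit Types (A B D E G K M N P Q S V W Z : lmodType R) (C Y : modclass R).

Definition injective_module N : Prop := forall B (U : B -> Prop) (f : B -> N),
  submod U -> linear_on U f -> exists g : {linear B -> N}, forall x, U x -> g x = f x.

Lemma enough_injectives N :
  exists2 I : lmodType R, injective_module I & exists i : {linear N -> I}, inj_map i.
Proof.
(* Hom_Z(R, (Q/Z)^N), with R acting by right translation. *)
pose H := {h : R -> N -> rat | forall r s n, h (r + s) n - (h r n + h s n) \is a Num.int}.
pose e (h h' : H) := forall r n, sval h r n - sval h' r n \is a Num.int.
have HP (h : H) r s n : sval h (r + s) n - (sval h r n + sval h s n) \is a Num.int.
  exact: svalP h r s n.
have i0 : (0 : rat) - (0 + 0) \is a Num.int by rewrite (_ : 0 - (0 + 0) = 0) ?rpred0 //; apply/eqP.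
have zP (r s : R) (n : N) := i0.
pose z : H := exist _ (fun _ _ => 0) zP.
have aP (h h' : H) r s n :
    (sval h (r + s) n + sval h' (r + s) n) -
      (sval h r n + sval h' r n + (sval h s n + sval h' s n)) \is a Num.int.
  by rewrite addrACA opprD addrACA rpredD // HP.
pose add (h h' : H) : H := exist _ (fun r n => sval h r n + sval h' r n) (aP h h').
have oP (h : H) r s n : - sval h (r + s) n - (- sval h r n - sval h s n) \is a Num.int.
  by rewrite -!opprD rpredN HP.
pose opp (h : H) : H := exist _ (fun r n => - sval h r n) (oP h).
have sP c (h : H) r s n :
    sval h ((r + s) * c) n - (sval h (r * c) n + sval h (s * c) n) \is a Num.int.
  by rewrite mulrDl HP.
pose scl c (h : H) : H := exist _ (fun r n => sval h (r * c) n) (sP c h).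
have [] := @setoid_module R H e z add opp scl; rewrite /e /=.
- by move=> h r n; rewrite subrr rpred0.
- by move=> h h' hh' r n; rewrite -opprB rpredN.
- by move=> h h' h'' hh' hh'' r n; rewrite -(subrK (sval h' r n) (sval h r n)) -addrA rpredD.
- by move=> h h' k k' hh' kk' r n; rewrite opprD addrACA rpredD.
- by move=> h h' hh' r n; rewrite -opprD rpredN.
- by move=> c h h' hh' r n.
- by move=> h h' h'' r n; rewrite addrA subrr rpred0.
- by move=> h h' r n; rewrite [X in X - _]addrC subrr rpred0.
- by move=> h r n; rewrite add0r subrr rpred0.
- by move=> h r n; rewrite addNr subrr rpred0.
- by move=> a b h r n; rewrite mulrA subrr rpred0.
- by move=> h r n; rewrite mulr1 subrr rpred0.
- by move=> a h h' r n; rewrite subrr rpred0.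
- by move=> h a b r n; rewrite mulrDr HP.
move=> I [p [psurj pP p0 pD pZ]].
have [rp rpK] := choice psurj.
pose ev (x : I) r n := sval (rp x) r n.
have evp h r n : ev (p h) r n - sval h r n \is a Num.int.
  by have /pP := rpK (p h); apply.
have ev_inj x y : (forall r n, ev x r n - ev y r n \is a Num.int) -> x = y.
  by move=> xy; rewrite -(rpK x) -(rpK y); apply/pP.
have evL c x y r n : ev (c *: x + y) r n - (ev x (r * c) n + ev y r n) \is a Num.int.
  by have := evp (add (scl c (rp x)) (rp y)) r n; rewrite pD pZ !rpK.
have evA x r s n : ev x (r + s) n - (ev x r n + ev x s n) \is a Num.int by apply: HP.
exists I.
- move=> B U f Us fL.
  (* A linear map into I is determined by its coordinates evaluated at 1, which are additive maps to
     Q/Z; each coordinate is extended separately. *)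
  have GE n : exists h : B -> rat, (forall x y, h (x + y) - (h x + h y) \is a Num.int) /\
      forall b, U b -> h b - ev (f b) 1 n \is a Num.int.
    pose G0 (q : B * rat) := U q.1 /\ q.2 - ev (f q.1) 1 n \is a Num.int.
    have ev0 : ev (f 0) 1 n \is a Num.int.
      by rewrite (linear_on0 (submod0 Us) fL) -p0; have := evp z 1 n; rewrite subr0.
    have [||h [hD hP]] := @rat_extension B G0.
    + split; first by split; [exact: submod0|rewrite /= sub0r rpredN].
      move=> x y [Ux xi] [Uy yi]; split; first exact: submodB.
      have -> : (x - y).1 = (-1) *: y.1 + x.1 by rewrite scaleN1r addrC.
      rewrite fL //; have := evL (-1) (f y.1) (f x.1) 1 n; rewrite mul1r => i1.
      have i2 : ev (f y.1) (-1) n + ev (f y.1) 1 n \is a Num.int.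
        have := evA (f y.1) (-1) 1 n; rewrite addNr.
        have i3 : ev (f y.1) 0 n \is a Num.int.
          have := evA (f y.1) 0 0 n; rewrite addr0 opprD addrA subrr sub0r.
          by rewrite rpredN.
        by move=> /(rpredB i3); rewrite subKr.
      have := rpredB (rpredB (rpredB xi yi) i1) i2.
      apply: int_eq => /=; ring.
    + by move=> d [_ /= di]; rewrite -(subrK (ev (f 0) 1 n) d) rpredD.
    exists h; split=> // b Ub.
    by apply: hP; split; rewrite //= subrr rpred0.
  have [g gP] := choice GE.
  have tP (b : B) r s n : g n ((r + s) *: b) - (g n (r *: b) + g n (s *: b)) \is a Num.int.
    by rewrite scalerDl; apply: (gP n).1.
  pose t b : H := exist _ (fun r n => g n (r *: b)) (tP b).
  have tL : linear (fun b => p (t b)).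
    move=> c x y; rewrite -pZ -pD; apply/pP => r n /=.
    by rewrite scalerDr scalerA; apply: (gP n).1.
  exists (mk_linear tL) => x Ux /=; apply: ev_inj => r n.
  have i1 := evp (t x) r n; have i2 := (gP n).2 _ (submodZ Us r Ux).
  have i3 := evL r (f x) 0 1 n; rewrite addr0 mul1r -(linear_onZ (submod0 Us) fL) // in i3.
  have i4 : ev 0 1 n \is a Num.int by rewrite -p0; have := evp z 1 n; rewrite subr0.
  have := rpredD (rpredD (rpredD i1 i2) i3) i4; apply: int_eq => /=; ring.
(* Coordinate n of the embedding uses a homomorphism that separates n from 0; injectivity at x is
   read off from coordinate x at 1. *)
- have sepP n : exists h : N -> rat, (forall x y, h (x + y) - (h x + h y) \is a Num.int) /\
      (n != 0 -> h n \isn't a Num.int).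
    have [->|/rat_separation [h [hD hn]]] := eqVneq n 0; last by exists h.
    by exists (fun _ => 0); split=> // x y; exact: i0.
  have [g gP] := choice sepP.
  have tP (b : N) r s n : g n ((r + s) *: b) - (g n (r *: b) + g n (s *: b)) \is a Num.int.
    by rewrite scalerDl; apply: (gP n).1.
  pose t b : H := exist _ (fun r n => g n (r *: b)) (tP b).
  have tL : linear (fun b => p (t b)).
    move=> c x y; rewrite -pZ -pD; apply/pP => r n /=.
    by rewrite scalerDr scalerA; apply: (gP n).1.
  exists (mk_linear tL); apply/injP => x /=; rewrite -p0 => /pP /(_ 1 x) /=.
  rewrite subr0 scale1r; apply: contraTeq; exact: (gP x).2.
Qed.

End Injectives.

(** * Cosyzygies and relative injectives *)

Section Cosyzygies.
Variable R : pzRingType.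
Implicit Types (A B D E G I K M N P Q S V W Z : lmodType R) (C Y : modclass R).

Lemma injective_orth M I : injective_module I -> orth M I.
Proof. by move=> Iinj Z q qs f fL; apply: Iinj => //; apply: submod_ker. Qed.

(** Only the values on the image of i matter, so f is a mere function, equal to 0 elsewhere. *)
Lemma extend_along_inj A B N (i : {linear A -> B}) (g : A -> N) : inj_map i ->
  exists f : B -> N, forall a, f (i a) = g a.
Proof.
move=> iI; exists (fun b => xget 0 (fun n => exists2 a, i a = b & n = g a)) => a.
by apply: xget_unique => [|n [a' /iI -> ->]]; first by exists a.
Qed.

(** Exactness of Ext^1(M, I) -> Ext^1(M, N1) -> Ext^2(M, N) = Ext^1(K, N), on the level of maps: a
    map K -> N1 lifts to I, and the lift extends to P. *)
Lemma orth_cokernel K P M N I N1 : ses K P M -> projective P -> ses N I N1 ->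
  orth M I -> orth K N -> orth M N1.
Proof.
move=> [i [p [iI ip ps]]] Pp [a [b [aI ab bs]]] oMI oKN.
apply: (orth_of_proj Pp ps) => f fL.
have [|fi fiP] := @linear_map R K N1 (fun k => f (i k)).
  by move=> r x y; rewrite linearP fL //; apply/ip; [exists x|exists y].
have [g gP] := orth_lift oKN (And3 aI ab bs) fi.
have [F FE] := extend_along_inj g iI.
have [|G GP] := oMI P p ps F.
  by move=> r _ _ /ip [x <-] /ip [y <-]; rewrite -linearP !FE linearP.
exists (b \o G) => z pz /=; rewrite GP //; have /ip [k <-] := pz.
by rewrite FE gP fiP.
Qed.

(** Both conditions say Ext^2(M, N) = 0, by a shift along P and a shift along I. *)
Lemma orth_shift K P M N I N1 : ses K P M -> projective P -> ses N I N1 ->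
  injective_module I -> orth K N <-> orth M N1.
Proof.
move=> sK Pp sN Iinj; split=> [|oKN].
  exact: orth_cokernel sK Pp sN (injective_orth Iinj).
move: sK sN => [i [p [iI ip ps]]] [a [b [aI ab bs]]].
move=> Z q qs f fL.
(* Modulo N the extension F induces h : K -> N1. Extending h to P, lifting it to I and subtracting
   it from F gives a map into N that is unchanged on the kernel of q. *)
have [|F FP] := Iinj Z (fun z => q z = 0) (fun z => a (f z)) (submod_ker q).
  by move=> r x y qx qy; rewrite fL // linearP.
have bF z : q z = 0 -> b (F z) = 0 by move=> qz; rewrite FP //; apply/ab; exists (f z).
have [] := @linear_rel R K N1 (fun k n => exists2 z, q z = k & b (F z) = n).
- by move=> k; have [z qz] := qs k; exists (b (F z)), z.
- by move=> r _ _ _ _ [x <- <-] [y <- <-]; exists (r *: x + y); rewrite !linearP.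
- by move=> _ [z /bF bFz <-].
move=> h hP; have hq z : h (q z) = b (F z).
  have [z' qz' <-] := hP (q z); apply/eqP; rewrite -subr_eq0 -!linearB; apply/eqP/bF.
  by rewrite linearB qz' subrr.
have [h' h'E] := extend_along_inj h iI.
have [|H HP] := oKN P p ps h'.
  by move=> r _ _ /ip [x <-] /ip [y <-]; rewrite -linearP !h'E linearP.
have [G GP] := Pp _ _ b H bs.
have bFG z : b (F z - G (i (q z))) = 0.
  by rewrite linearB GP HP ?h'E ?hq ?subrr //; apply/ip; exists (q z).
have [] := @linear_rel R Z N (fun z n => a n = F z - G (i (q z))).
- by move=> z; apply/ab.
- move=> r x x' y y'; rewrite linearP => -> ->.
  by rewrite (linearP q) (linearP i) (linearP F) (linearP G) scalerBr opprD addrACA.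
- by move=> n; rewrite !linear0 addr0; apply: inj0.
move=> g gP; exists g => z qz; apply: aI.
by rewrite gP FP // qz !linear0 addr0.
Qed.

Fixpoint cosyzygy n : modclass R :=
  if n is k.+1 then fun Z => exists N I, [/\ ses N I Z, injective_module I & cosyzygy k N]
  else fun _ => True.

(** Dimension shifting trades the n syzygies of M for n cosyzygies of the test module, so that
    bounded projective dimension becomes an Ext^1 orthogonality. *)
Lemma pdim_projectiveP n M :
  pdim_le (@projective R) n M <-> forall Z, cosyzygy n Z -> orth M Z.
Proof.
elim: n M => [|n IH] M /=.
  by split=> [Mp Z _|oM]; [apply: projective_orth|apply/projectiveP => N; apply: oM].
split=> [[K [P [sK Pp /IH oK]]] Z [N [I [sN Iinj /oK cN]]]|oM].
  exact/(orth_shift sK Pp sN Iinj).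
have [K [P [sK Pp]]] := syzygy_exists M; exists K, P; split=> //.
apply/IH => N cN; have [I Iinj [i iI]] := enough_injectives N.
have [Z [q se]] := ses_of_inj iI.
have sN : ses N I Z by exists i, q.
by apply/(orth_shift sK Pp sN Iinj)/oM; exists N, I.
Qed.

(** The pushout of the inclusion of the kernel of q along f is an extension E of M by N. Subtracting
    the section after q from Z -> E leaves a map into N that extends f. *)
Lemma orth_of_split M N :
  (forall E (i : {linear N -> E}) (q : {linear E -> M}), short_exact i q ->
     exists s : {linear M -> E}, forall x, q (s x) = x) -> orth M N.
Proof.
move=> spl Z q qs f fL; have f0 : f 0 = 0 by apply: linear_on0 fL; rewrite linear0.
have Us : @submod R (Z * N)%type (fun x => q x.1 = 0 /\ x.2 = - f x.1).
  split=> [|r x y [qx xf] [qy yf]]; first by rewrite /= linear0 f0 oppr0.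
  split; first by rewrite !linearP qx qy scaler0 addr0.
  have -> : (r *: x + y).1 = r *: x.1 + y.1 by [].
  by rewrite fL // opprD -scalerN -xf -yf.
have [E [p [ps pP]]] := quot_module Us.
have iL : linear (fun x : N => p (0, x)).
  by move=> r x x'; rewrite -linearP; congr (p (_, _)); rewrite /= scaler0 addr0.
have jL : linear (fun x : Z => p (x, 0)).
  by move=> r x x'; rewrite -linearP; congr (p (_, _)); rewrite /= scaler0 addr0.
have [] := @linear_rel R E M (fun e m => exists2 x, p x = e & q x.1 = m).
+ by move=> e; have [x px] := ps e; exists (q x.1), x.
+ by move=> r _ _ _ _ [x <- <-] [x' <- <-]; exists (r *: x + x'); rewrite !linearP.
+ by move=> _ [x /pP [qx _] <-].
move=> u uP; have up x : u (p x) = q x.1.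
  have [x' pxx' <-] := uP (p x); apply/eqP; rewrite -subr_eq0 -linearB; apply/eqP.
  by have /pP [] : p (x' - x) = 0 by rewrite linearB pxx' subrr.
have ji z : q z = 0 -> p (z, 0) = p (0, f z).
  move=> qz; apply/eqP; rewrite -subr_eq0 -linearB; apply/eqP/pP.
  by rewrite /= !subr0 sub0r.
have iE z : u z = 0 <-> exists n, p (0, n) = z.
  split=> [|[n <-]]; last by rewrite up linear0.
  have [[a b] <-] := ps z; rewrite up /= => qa; exists (f a + b).
  have -> : (a, b) = (a, 0) + (0, b) by congr (_, _); rewrite /= ?addr0 ?add0r.
  by rewrite linearD ji // -linearD; congr (p (_, _)); rewrite /= addr0.
have [|s sP] := spl E (mk_linear iL) u.
  split=> //.
  + by apply/injP => n /= /pP [_] /=; rewrite f0 oppr0.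
  + by move=> m; have [z qz] := qs m; exists (p (z, 0)); rewrite up.
have [] := @linear_rel R Z N (fun z n => p (0, n) = p (z, 0) - s (q z)).
+ by move=> z; apply/iE; rewrite linearB up sP subrr.
+ move=> r x x' y y' e1 e2; rewrite [LHS](iL r) e1 e2 (jL r) (linearP q) (linearP s).
  by rewrite scalerBr opprD addrACA.
+ move=> n; rewrite !linear0 addr0 => /pP [_] /=.
  by rewrite f0 oppr0.
move=> g gP; exists g => z qz.
have /eqP : p (0, g z) = p (0, f z) by rewrite gP qz linear0 subr0 ji.
rewrite -subr_eq0 -linearB => /eqP /pP [_] /=.
by rewrite subrr f0 oppr0 => /eqP; rewrite subr_eq0 => /eqP.
Qed.

End Cosyzygies.

(** * Envelopes by modules injective relative to a family *)

Section SmallObject.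
Variables (R : pzRingType) (F : lmodType R) (UU : (F -> Prop) -> Prop).
Hypotheses (Fp : projective F) (UUs : forall U, UU U -> submod U).
Implicit Types (A B D E G I J K M N P Q S V W Z : lmodType R).

Definition family_injective Z : Prop := forall U (f : F -> Z), UU U -> linear_on U f ->
  exists g : {linear F -> Z}, forall x, U x -> g x = f x.

Lemma family_injective_op Z : family_injective Z ->
  exists o : (F -> Prop) -> (F -> Z) -> F -> Z, (forall U f, linear (o U f)) /\
    forall U f x, UU U -> linear_on U f -> U x -> o U f x = f x.
Proof.
move=> Zinj.
have /choice [o oP] : forall p : (F -> Prop) * (F -> Z), exists g : {linear F -> Z},
    UU p.1 -> linear_on p.1 p.2 -> forall x, p.1 x -> g x = p.2 x.
  move=> [U f] /=; case: (pselect (UU U /\ linear_on U f)) => [[UUU fL]|nUf].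
    by have [g gP] := Zinj U f UUU fL; exists g.
  by exists \0 => UUU fL; case: nUf.
exists (fun U f => o (U, f)); split=> [U f r x y|U f x UUU fL Ux].
  exact: linearP.
exact: (oP (U, f)).
Qed.

(* An extension of A by Z is split by pulling it back to V over J: V carries
   operators lifting those of J because Z is relatively injective, so freeness
   of J gives a section J -> V which sends N into the zero fibre. *)
Lemma family_envelope N : exists J A,
  [/\ ses N J A, family_injective J & forall Z, family_injective Z -> orth A Z].
Proof.
have [J [g [o [[gE oL oE] univ ind]]]] :=
  @skolem_hull R F UU N (fun x r y t => x = r *: y + t).
have gL : linear g by move=> r x y; apply: gE.
(* N embeds in an injective module I, which carries operators; the induced map J -> I restricts to
   this embedding. *)
have gI : inj_map (mk_linear gL).
  have [I Iinj [j jI]] := enough_injectives N.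
  have [|o' [o'L o'E]] := @family_injective_op I.
    by move=> U f /UUs Us fL; apply: Iinj.
  have [|h [hg _]] := univ I j o' _ o'L o'E; first by move=> x r y t ->; rewrite linearP.
  by move=> x y /= gxy; apply: jI; rewrite -!hg gxy.
have [A [p se]] := ses_of_inj gI; have [_ gp ps] := se.
exists J, A; split; first by exists (mk_linear gL), p.
  by move=> U f UUU fL; exists (mk_linear (oL U f)) => x Ux /=; apply: oE.
move=> Z Zinj; apply: orth_of_split => E i q [iI iq qs].
have [V [u [v [uv uvE uv0]]]] := pullback p q.
have us : surj_map u.
  by move=> x; have [e qe] := qs (p x); have [w uw _] := uvE _ _ (esym qe); exists w.
have [] := @linear_rel R N V (fun n w => u w = g n /\ v w = 0).
- move=> n; have [|w uw vw] := uvE (g n) 0; last by exists w.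
  by rewrite linear0; apply/gp; exists n.
- by move=> r x x' y y' [py qy] [py' qy']; rewrite !linearP py qy py' qy' gL scaler0 addr0.
- by move=> w [uw vw]; apply: uv0; rewrite // uw -(linear0 (mk_linear gL)).
move=> g' g'P.
(* A lift [l] of the operator of J is corrected by a map into the kernel Z of u, so that it also
   extends the given function on U. *)
have /choice [o' o'P] : forall c : (F -> Prop) * (F -> V), exists k : {linear F -> V},
    (forall y, u (k y) = o c.1 (fun x => u (c.2 x)) y) /\
    (UU c.1 -> linear_on c.1 c.2 -> forall x, c.1 x -> k x = c.2 x).
  move=> [U f] /=; have [l lP] := Fp (mk_linear (oL U (fun x => u (f x)))) us.
  case: (pselect (UU U /\ linear_on U f)) => [[UUU fL]|nUf]; last first.
    by exists l; split=> // UUU fL; case: nUf.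
  have ufL : linear_on U (fun x => u (f x)) by move=> r x y Ux Uy; rewrite fL ?linearP.
  have /choice [k kP] : forall x, exists n, U x -> i n = v (f x - l x).
    move=> x; case: (pselect (U x)) => [Ux|nU]; last by exists 0.
    have /iq [n <-] : q (v (f x - l x)) = 0; last by exists n.
    by rewrite -uv linearB lP /= oE // subrr linear0.
  have [|k' k'P] := Zinj U k UUU.
    move=> r x y Ux Uy; apply: iI; rewrite linearP !kP //; last by apply: (UUs UUU).2.
    by rewrite fL // (linearP l) -(linearP v) scalerBr opprD addrACA.
  have [] := @linear_rel R Z V (fun n w => u w = 0 /\ v w = i n).
  + move=> n; have [|w uw vw] := uvE 0 (i n); last by exists w.
    by rewrite linear0; apply/esym/iq; exists n.
  + by move=> r x x' y y' [py qy] [py' qy']; rewrite !linearP py qy py' qy' scaler0 addr0.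
  + by move=> w [uw vw]; apply: uv0; rewrite // vw linear0.
  move=> j jP; have [m mP] := lin_addcomp l j k'; exists m; split=> [y|_ _ x Ux].
    by rewrite mP linearD lP (jP _).1 addr0.
  apply/eqP; rewrite -subr_eq0; apply/eqP; rewrite mP k'P //; apply: uv0.
    by rewrite linearB linearD lP (jP _).1 addr0 /= oE // subrr.
  by rewrite linearB linearD (jP _).2 kP // (linearB v) [X in X - _]addrC subrK subrr.
have [|||h [hg ho]] := univ V g' (fun U f => o' (U, f)).
- by move=> x r y t ->; rewrite linearP.
- by move=> U f r x y; apply: linearP.
- by move=> U f x UUU fL Ux; apply: (o'P (U, f)).2.
have uh x : u (h x) = x.
  apply: (ind (fun x => u (h x) = x)) => [|n|U f y UUU Vf].
  + by split=> [|r y t hy ht]; rewrite ?linear0 // !linearP hy ht.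
  + by rewrite hg (g'P n).1.
  + by rewrite ho // (o'P (U, _)).1 /=; congr (o U _ y); apply/funext.
have [] := @linear_rel R A E (fun a e => exists2 x, p x = a & v (h x) = e).
- by move=> a; have [x px] := ps a; exists (v (h x)), x.
- by move=> r _ _ _ _ [x <- <-] [y <- <-]; exists (r *: x + y); rewrite !linearP.
- by move=> _ [x /gp [n <-] <-]; rewrite /= hg (g'P n).2.
by move=> s sP; exists s => a; have [x <- <-] := sP a; rewrite -uv uh.
Qed.

End SmallObject.

(** * Small subsystems of projective resolutions *)

Section Subquotients.
Variable R : pzRingType.
Implicit Types (M N P Q : lmodType R).

Lemma submod_sum (I : Type) M (V : M -> Prop) (s : seq I) (f : I -> M) :
  submod V -> (forall k, V (nth 0 [seq f i | i <- s] k)) -> V (\sum_(i <- s) f i).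
Proof.
move=> Vs; elim: s => [|i s IH] Vf; first by rewrite big_nil; apply: submod0.
rewrite big_cons; apply: submodD => //; first exact: (Vf 0%N).
by apply: IH => k; apply: (Vf k.+1).
Qed.

(** [l x] represents the image of x under a linear section of the free module on P. Linearity is
    tested by all functions a on P, since representing lists are not unique. *)
Definition dual_basis P (l : P -> seq (R * P)) : Prop :=
  (forall x, x = \sum_(c <- l x) c.1 *: c.2) /\
  forall N (a : P -> N), linear (fun x => \sum_(c <- l x) c.1 *: a c.2).

Lemma projective_dual_basis P : projective P -> exists l : P -> seq (R * P), dual_basis l.
Proof.
move=> Pp; have [F [inc [univ ind]]] := free_module R P.
have [p pP] := univ P id.
have ps : surj_map p by move=> x; exists (inc x).
have [s sP] := Pp _ _ p (idfun : {linear P -> P}) ps.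
have [l lP] := choice (fun x => free_combination ind (s x)).
have lL N (a : P -> N) : exists h : {linear F -> N},
    forall x, \sum_(c <- l x) c.1 *: a c.2 = h (s x).
  have [h hP] := univ N a; exists h => x; rewrite lP linear_sum /=.
  by apply: eq_bigr => c _; rewrite linearZ hP.
exists l; split=> [x|N a].
- rewrite -{1}[x]/(idfun x) -sP lP linear_sum /=.
  by apply: eq_bigr => c _; rewrite linearZ pP.
- by have [h hP] := lL N a; move=> r x y; rewrite !hP !linearP.
Qed.

(* A splitting of the free module on P over P sends A into the span of the
   generators in A; the quantification over N and V states this without naming
   the free module. *)
Definition basis_closed P (l : P -> seq (R * P)) (A : P -> Prop) : Prop :=
  forall x, A x -> forall N (a : P -> N) (V : N -> Prop), submod V ->
    (forall y, A y -> V (a y)) -> V (\sum_(c <- l x) c.1 *: a c.2).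

(* p is only meaningful on B, where it is the projection onto B / A. *)
Definition subquotient M (A B : M -> Prop) Q (p : M -> Q) : Prop :=
  [/\ linear_on B p, forall y, exists2 b, B b & p b = y & forall b, B b -> p b = 0 <-> A b].

Lemma subquotient_exists M (A B : M -> Prop) : submod A -> submod B ->
  exists Q (p : M -> Q), subquotient A B p.
Proof.
move=> As Bs; have [S [i [iI iP]]] := sub_module Bs.
have [Q [p [ps pP]]] := quot_module (submod_preim i As).
have [f fE] := extend_along_inj p iI; exists Q, f; split.
- by move=> r _ _ /iP [x <-] /iP [y <-]; rewrite -linearP !fE linearP.
- by move=> y; have [x <-] := ps y; exists (i x); [apply/iP; exists x|exact: fE].
- by move=> _ /iP [x <-]; rewrite fE.
Qed.

Lemma subquotientB M (A B : M -> Prop) Q (p : M -> Q) : submod B -> subquotient A B p ->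
  forall x y, B x -> B y -> p (x - y) = p x - p y.
Proof.
by move=> Bs [pL _ _] x y Bx By; rewrite -!scaleN1r addrC pL // addrC.
Qed.

Lemma subquotient_map M N (A B : M -> Prop) (A' B' : N -> Prop) Q Q' (p : M -> Q) (p' : N -> Q')
    (f : M -> N) : submod B -> submod B' -> subquotient A B p -> subquotient A' B' p' ->
    linear_on B f -> (forall x, B x -> B' (f x)) -> (forall x, B x -> A x -> A' (f x)) ->
  exists h : {linear Q -> Q'}, forall x, B x -> h (p x) = p' (f x).
Proof.
move=> Bs Bs' pq pq' fL fB fA; have [pL ps pA] := pq; have [pL' ps' pA'] := pq'.
have [] := @linear_rel R Q Q' (fun y z => exists x, [/\ B x, p x = y & p' (f x) = z]).
- by move=> y; have [x Bx <-] := ps y; exists (p' (f x)), x.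
- move=> r _ _ _ _ [x [Bx <- <-]] [y [By <- <-]]; exists (r *: x + y).
  by rewrite pL // fL // pL' //; [split=> //; apply: Bs.2|apply: fB|apply: fB].
- by move=> _ [x [Bx /(pA _ Bx) Ax <-]]; apply/pA'; [apply: fB|apply: fA].
move=> h hP; exists h => x Bx; have [x' [Bx' pxx' <-]] := hP (p x).
have Bxx' : B (x' - x) by apply: submodB.
have : A' (f (x' - x)).
  by apply: fA => //; apply/pA => //; rewrite (subquotientB Bs pq) // pxx' subrr.
have -> : f (x' - x) = f x' - f x by rewrite -!scaleN1r addrC fL // addrC.
move/pA'; rewrite (subquotientB Bs' pq'); try exact: fB.
by move=> h0; apply/eqP; rewrite -subr_eq0; apply/eqP/h0; apply: submodB => //; apply: fB.
Qed.

(** Preimages of f (p x), chosen to be 0 on A, are summed along the dual basis. Closedness of B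
    makes the sum a lift of f after p on B, closedness of A makes it vanish on A. *)
Lemma subquotient_projective P (l : P -> seq (R * P)) (A B : P -> Prop) Q (p : P -> Q) :
    dual_basis l -> submod A -> submod B -> (forall x, A x -> B x) ->
    basis_closed l A -> basis_closed l B -> subquotient A B p -> projective Q.
Proof.
move=> [lE lL] As Bs AB Al Bl pq; have [pL ps pA] := pq; move=> M N g f gs.
have /choice [a aP] : forall x, exists y, (B x -> g y = f (p x)) /\ (A x -> y = 0).
  move=> x; case: (pselect (A x)) => [Ax|nA].
    exists 0; split=> // Bx; rewrite linear0 (_ : p x = 0) ?linear0 //.
    exact/(pA _ Bx).
  by have [y gy] := gs (f (p x)); exists y.
pose h := mk_linear (lL _ a).
have hg x : B x -> g (h x) = f (p x).
  move=> Bx; pose V (q : M * P) := B q.2 /\ g q.1 = f (p q.2).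
  have Vs : @submod R (M * P)%type V.
    split=> [|r y z [By gy] [Bz gz]].
      by split; [exact: submod0|rewrite /= (linear_on0 (submod0 Bs) pL) !linear0].
    split; first exact: Bs.2.
    by rewrite /= pL // !linearP gy gz.
  have [|_ /=] := Bl x Bx _ (fun y => (a y, y) : (M * P)%type) V Vs.
    by move=> y By; split=> //=; apply: (aP y).1.
  rewrite (linear_sum (fst : {linear (M * P)%type -> M})).
  by rewrite (linear_sum (snd : {linear (M * P)%type -> P})) /= -lE.
have hA x : A x -> h x = 0.
  move=> Ax; apply: (Al x Ax M a (fun y => y = 0)) => [|y /(aP y).2 //].
  by split=> // r y z -> ->; rewrite scaler0 addr0.
have [] := @linear_rel R Q M (fun y z => exists x, [/\ B x, p x = y & h x = z]).
- by move=> y; have [x Bx <-] := ps y; exists (h x), x.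
- move=> r _ _ _ _ [x [Bx <- <-]] [y [By <- <-]]; exists (r *: x + y).
  by rewrite pL // linearP; split=> //; apply: Bs.2.
- by move=> _ [x [Bx /(pA _ Bx) Ax <-]]; apply: hA.
by move=> k kP; exists k => y; have [x [Bx <- <-]] := kP y; rewrite hg.
Qed.

End Subquotients.

Section Deconstruction.
Variable R : pzRingType.
Implicit Types (A B D E G I J K M N P Q S W Z : lmodType R).

(* These terms bound the size of the subsystem generated by one element, so they
   play the role of a cardinal. *)
Inductive rterm : nat -> Type :=
| RGen n : rterm n
| RComb n : R -> rterm n -> rterm n -> rterm n
| RDiff n : rterm n.+1 -> rterm n
| RSupp n : nat -> rterm n -> rterm n
| RPre n : rterm n -> rterm n.+1.

Section ClosedSubsystems.
Variables (W : lmodType R) (T : left_resolution W).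
Variable l : forall n, T n -> seq (R * T n).
Hypothesis lP : forall n, dual_basis (@l n).

Definition cycle_at n : T n -> Prop :=
  match n return T n -> Prop with
  | 0 => fun x => res_aug T x = 0
  | k.+1 => fun x => res_diff T k x = 0
  end.

Lemma cycle_atP n x : @cycle_at n x <-> exists y, res_diff T n y = x.
Proof. by case: n x => [|n] x; [apply: res_exact0|apply: res_exactS]. Qed.

Lemma cycle_at_submod n : submod (@cycle_at n).
Proof. by case: n => [|n]; apply: submod_ker. Qed.

Lemma cycle_at_diff n y : @cycle_at n (res_diff T n y).
Proof. by apply/cycle_atP; exists y. Qed.

(** [cl_exact] and [cl_basis] ensure that the quotients of two nested closed subsystems form a
    projective resolution. *)
Record closed (Y : forall n, T n -> Prop) : Prop := Closed {
  cl_submod : forall n, submod (@Y n);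
  cl_diff : forall n x, @Y n.+1 x -> Y n (res_diff T n x);
  cl_basis : forall n, basis_closed (@l n) (@Y n);
  cl_exact : forall n x, @Y n x -> cycle_at x -> exists2 y, @Y n.+1 y & res_diff T n y = x
}.

(** Cycles up to an error in Y. Choosing preimages for these lets [hull_closed] treat the generated
    summand of an element by a single term, independently of its summand in Y. *)
Definition rel_cycle (Y : forall n, T n -> Prop) n (x : T n) : Prop :=
  exists2 y, Y n y & cycle_at (x - y).

Lemma rel_cycleS Y n x : closed Y -> Y n (res_diff T n x) -> rel_cycle Y x.
Proof.
move=> cY Yd; have [y Yy dy] := cl_exact cY Yd (cycle_at_diff x).
by exists y => //=; rewrite linearB dy subrr.
Qed.

Section Hull.
Variables (Y : forall n, T n -> Prop) (g : forall n, T n) (pre : forall n, T n -> T n.+1).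
Hypothesis cY : closed (@Y).
Hypothesis preP : forall n x, rel_cycle (@Y) x -> @Y n (x - res_diff T n (pre x)).

Fixpoint reval n (t : rterm n) : T n :=
  match t in rterm n return T n with
  | RGen n => g n
  | RComb n r s t => r *: reval s + reval t
  | RDiff n t => res_diff T n (reval t)
  | RSupp n k t => nth 0 [seq c.2 | c <- l (reval t)] k
  | RPre n t => pre (reval t)
  end.

Definition hull n (x : T n) : Prop := exists y t, @Y n y /\ x = y + reval t.

Lemma reval_submod n : submod (fun x => exists t : rterm n, reval t = x).
Proof.
split=> [|r _ _ [s <-] [t <-]]; last by exists (RComb r s t).
by exists (RComb (-1) (RGen n) (RGen n)); rewrite /= scaleN1r addNr.
Qed.

Lemma sub_hull n x : @Y n x -> hull x.
Proof.
move=> Yx; have [t t0] := submod0 (reval_submod n).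
by exists x, t; rewrite t0 addr0.
Qed.

Lemma reval_hull n (t : rterm n) : hull (reval t).
Proof. by exists 0, t; rewrite add0r; split=> //; exact: submod0 (cl_submod cY n). Qed.

Lemma hull_submod n : submod (@hull n).
Proof.
split=> [|r _ _ [x [s [Yx ->]]] [y [t [Yy ->]]]]; first exact: sub_hull (submod0 (cl_submod cY n)).
exists (r *: x + y), (RComb r s t); split; first exact: (cl_submod cY n).2.
by rewrite /= scalerDr addrACA.
Qed.

Lemma hull_closed : closed hull.
Proof.
split.
- exact: hull_submod.
- move=> n _ [y [t [Yy ->]]]; exists (res_diff T n y), (RDiff t).
  by rewrite linearD; split=> //; apply: cl_diff.
- move=> n _ [y [t [Yy ->]]] N a V Vs Va.
  have := (lP n).2 N a 1 y (reval t); rewrite !scale1r => ->; apply: submodD => //.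
    by apply: (cl_basis cY Yy Vs) => x Yx; apply: Va; apply: sub_hull.
  apply: submod_sum => // k; have [ks|ks] := ltnP k (size (l (reval t))); last first.
    by rewrite nth_default ?size_map //; apply: submod0.
  rewrite (nth_map (0, 0)) //; apply: submodZ => //; apply: Va.
  have := reval_hull (RSupp k t).
  by rewrite /= (nth_map (0, 0)).
(* Replacing the generated summand by its difference from the boundary of its chosen preimage leaves
   a cycle in Y, which has a preimage in Y. *)
- move=> n _ [y [t [Yy ->]]] cyt.
  have rt : rel_cycle (@Y) (reval t).
    by exists (- y); [exact: (submodN (cl_submod cY n) Yy)|rewrite opprK addrC].
  have Yd := preP rt.
  have [||z Yz dz] := cl_exact cY (n := n) (x := y + (reval t - res_diff T n (pre (reval t)))).
  + exact: (submodD (cl_submod cY n) Yy Yd).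
  + rewrite addrA; exact: (submodB (cycle_at_submod n) cyt (cycle_at_diff _)).
  exists (z + reval (RPre t)); last by rewrite linearD dz /= addrA subrK.
  by exists z, (RPre t).
Qed.

End Hull.

End ClosedSubsystems.
End Deconstruction.

(** * The family of U with F/U of bounded projective dimension *)

Section SmallFamily.
Variables (R : pzRingType) (m : nat) (F : lmodType R) (inc : rterm R 0 -> F).
Hypothesis univ : forall (A : lmodType R) (a : rterm R 0 -> A),
  exists h : {linear F -> A}, forall x, h (inc x) = a x.
Hypothesis ind : forall V, submod V -> (forall x, V (inc x)) -> forall z, V z.
Implicit Types (A B D E G I J K M N P Q S W Z : lmodType R).

Definition small_family (U : F -> Prop) : Prop :=
  submod U /\ exists Q (r : {linear F -> Q}),
    [/\ surj_map r, forall z, r z = 0 <-> U z & wedge (@projective R) m Q].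

Section Step.
Variables (W : lmodType R) (T : left_resolution W).
Variable l : forall n, T n -> seq (R * T n).
Hypothesis lP : forall n, dual_basis (@l n).
Hypothesis T0 : forall i, (m < i)%N -> zero_module (T i).

Definition aug_im (Y : forall n, T n -> Prop) (w : W) : Prop :=
  exists2 x, Y 0%N x & res_aug T x = w.

Lemma aug_im_submod Y : closed l Y -> submod (aug_im Y).
Proof. by move=> cY; apply/submod_image/(cl_submod cY). Qed.

(** Y' is the hull of Y and the [g n]. In degree 0 it is Y plus an image of F, so F/U is the
    quotient of [aug_im Y'] by [aug_im Y], and the quotients of Y' by Y resolve it by projectives,
    with zero terms beyond degree m. *)
Lemma closed_step (Y : forall n, T n -> Prop) : closed l Y -> forall g : forall n, T n,
  exists (Y' : forall n, T n -> Prop) (a : {linear F -> W}),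
  [/\ closed l Y', forall n x, Y n x -> Y' n x, forall n, Y' n (g n),
      forall w, aug_im Y' w <-> exists u z, aug_im Y u /\ w = u + a z
    & small_family (fun z => aug_im Y (a z))].
Proof.
move=> cY g.
have preE n : exists f : T n -> T n.+1, forall x, rel_cycle Y x -> Y n (x - res_diff T n (f x)).
  have /choice [f fP] : forall x : T n, exists w, rel_cycle Y x -> Y n (x - res_diff T n w).
    move=> x; case: (pselect (rel_cycle Y x)) => [[y Yy]|nx]; last by exists 0.
    by move=> /cycle_atP [w dw]; exists w; rewrite dw subKr.
  by exists f.
pose pre n := sval (cid (preE n)).
have preP n : forall x, rel_cycle Y x -> Y n (x - res_diff T n (pre n x)) := svalP (cid (preE n)).
pose ev n := @reval R W T l g pre n.
pose Y' n : T n -> Prop := @hull R W T l Y g pre n.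
have cY' : closed l Y' by apply: hull_closed.
have YY' n x : Y n x -> Y' n x by apply: sub_hull.
have evY' n t : Y' n (ev n t) by apply: reval_hull.
have [eh ehP] := univ (ev 0%N).
have ehE z : exists t, ev 0%N t = eh z.
  have Vs : submod (fun z => exists t, ev 0%N t = eh z).
    exact: (submod_preim eh (reval_submod l g pre 0)).
  by apply: (ind Vs) => t; exists t; rewrite ehP.
have Y'E x : Y' 0%N x <-> exists y z, Y 0%N y /\ x = y + eh z.
  split=> [[y [t [Yy ->]]]|[y [z [Yy ->]]]].
    by exists y, (inc t); rewrite ehP.
  by have [t <-] := ehE z; exists y, t.
pose a : {linear F -> W} := res_aug T \o eh.
have Us : submod (fun z => aug_im Y (a z)) by apply/submod_preim/aug_im_submod.
exists Y', a; split=> //.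
- by move=> n; apply: (evY' n (RGen R n)).
- move=> w; split=> [[x /Y'E [y [z [Yy ->]]] <-]|[_ [z [[y Yy <-] ->]]]].
    by exists (res_aug T y), z; split; [exists y|rewrite linearD].
  by exists (y + eh z); [apply/Y'E; exists y, z|rewrite linearD].
split=> //; have [Q [r [rs rP]]] := quot_module Us; exists Q, r; split=> //.
have sqE n := subquotient_exists (cl_submod cY n) (cl_submod cY' n).
pose S n := sval (cid (sqE n)).
pose p n : T n -> S n := sval (cid (svalP (cid (sqE n)))).
have pq n : subquotient (Y n) (Y' n) (p n) := svalP (cid (svalP (cid (sqE n)))).
have pL n : linear_on (Y' n) (p n) by have [] := pq n.
have ps n y : exists2 b, Y' n b & p n b = y by have [] := pq n.
have p0 n b : Y' n b -> p n b = 0 <-> Y n b by have [_ _] := pq n; apply.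
have dE n : exists h : {linear S n.+1 -> S n},
    forall x, Y' n.+1 x -> h (p n.+1 x) = p n (res_diff T n x).
  apply: (subquotient_map (cl_submod cY' _) (cl_submod cY' _) (pq n.+1) (pq n)) => //.
  - exact: linear_on_linear.
  - by move=> x; apply: (cl_diff cY').
  - by move=> x _; apply: (cl_diff cY).
pose d n := sval (cid (dE n)).
have dP n x : Y' n.+1 x -> d n (p n.+1 x) = p n (res_diff T n x) := svalP (cid (dE n)) x.
(* The augmentation of the quotient resolution: the class of b goes to r z when the augmentation of
   b agrees with a z modulo [aug_im Y]. *)
pose G (y : S 0%N) (q : Q) :=
  exists b z, [/\ Y' 0%N b, p 0%N b = y, r z = q & aug_im Y (res_aug T b - a z)].
have aIs := aug_im_submod cY.
have [] := @linear_rel R (S 0%N) Q G.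
- move=> y; have [b Yb <-] := ps 0%N y; have /Y'E [y0 [z [Yy bE]]] := Yb.
  exists (r z), b, z; split=> //; exists y0 => //.
  by rewrite bE linearD addrK.
- move=> c y y' q q' [b [z [Yb <- <- ab]]] [b' [z' [Yb' <- <- ab']]].
  exists (c *: b + b'), (c *: z + z').
  split; [exact: (cl_submod cY' 0).2|by rewrite pL|by rewrite linearP|].
  rewrite (linearP (res_aug T)) (linearP a) opprD addrACA -scalerBr.
  exact: aIs.2.
- move=> q [b [z [Yb /(p0 _ _ Yb) Yb0 <- ab]]]; apply/rP.
  rewrite -(subKr (res_aug T b) (a z)); apply: submodB => //; by exists b.
move=> h hP.
have hE b z : Y' 0%N b -> aug_im Y (res_aug T b - a z) -> h (p 0%N b) = r z.
  move=> Yb ab; have [b' [z' [Yb' pb' <- ab']]] := hP (p 0%N b).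
  apply/eqP; rewrite -subr_eq0 -linearB; apply/eqP/rP.
  have Ybb : Y 0%N (b' - b).
    apply/p0; first by apply: submodB => //; apply: cl_submod cY' 0%N.
    by rewrite (subquotientB (cl_submod cY' 0%N) (pq 0%N)) // pb' subrr.
  have i1 : aug_im Y (res_aug T (b' - b)) by exists (b' - b).
  have E (u v x y : W) : u - v - (u - x) + (v - y) = x - y.
    by rewrite opprB [u - v + _]addrC (addrA (x - u)) subrK (addrA (x - v)) subrK.
  have := submodD aIs (submodB aIs i1 ab') ab.
  by rewrite (linearB (res_aug T)) (linearB a) E.
have hs : surj_map h.
  move=> q; have [z <-] := rs q; have [t tE] := ehE z.
  have Ye : Y' 0%N (eh z) by rewrite -tE.
  by exists (p 0%N (eh z)); apply: hE => //; rewrite subrr; apply: submod0.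
have ex0 : exact_at (d 0%N) h.
  move=> y; have [b Yb <-] := ps 0%N y; split.
    have [b' [z [Yb' pb' <- [y1 Yy1 y1E]]]] := hP (p 0%N b); move=> /rP [y2 Yy2 y2E].
    have Yb'y : Y' 0%N (b' - (y1 + y2)).
      apply: (submodB (cl_submod cY' 0) Yb'); apply: YY'.
      exact: (submodD (cl_submod cY 0)).
    have [|y3 Yy3 y3E] := cl_exact cY' Yb'y.
      by rewrite /= linearB linearD y1E y2E subrK subrr.
    exists (p 1%N y3); rewrite dP // y3E (subquotientB (cl_submod cY' 0%N) (pq 0%N)) //.
      rewrite pb' [p _ (y1 + y2)](p0 _ _ _).2 ?subr0 //; last by apply: (submodD (cl_submod cY 0)).
      by apply: YY'; apply: (submodD (cl_submod cY 0)).
    by apply: YY'; apply: (submodD (cl_submod cY 0)).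
  move=> [u <-]; have [y1 Yy1 <-] := ps 1%N u; rewrite dP //.
  rewrite (hE _ 0); [by rewrite linear0|exact: (cl_diff cY')|].
  by rewrite [a 0]linear0 subr0 (@res_exact0 _ _ T _).2; [apply: submod0|exists y1].
have exS n : exact_at (d n.+1) (d n).
  move=> y; have [b Yb <-] := ps n.+1 y; split.
    rewrite dP // => /p0 - /(_ (cl_diff cY' Yb)) Yd.
    have [y1 Yy1 cy1] := rel_cycleS cY Yd.
    have Yby : Y' n.+1 (b - y1) by apply: (submodB (cl_submod cY' _)) => //; apply: YY'.
    have [y2 Yy2 dy2] := cl_exact cY' Yby cy1.
    exists (p n.+2 y2); rewrite dP // dy2.
    rewrite (subquotientB (cl_submod cY' _) (pq n.+1)) //; last exact: YY'.
    by rewrite [p _ y1](p0 _ _ _).2 ?subr0 //; apply: YY'.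
  move=> [u uE]; have [y1 Yy1 yE] := ps n.+2 u; rewrite -yE dP // in uE.
  rewrite -uE dP; last exact: (cl_diff cY').
  rewrite (@res_exactS _ _ T n _).2; last by exists y1.
  by apply/p0; [exact: (submod0 (cl_submod cY' n))|exact: (submod0 (cl_submod cY n))].
exists (LeftResolution hs ex0 exS), m; split=> // i im /=.
- apply: (subquotient_projective (lP i) (cl_submod cY i) (cl_submod cY' i)) (pq i) => //.
  + exact: YY'.
  + exact: (cl_basis cY).
  + exact: (cl_basis cY').
- move=> y; have [b Yb <-] := ps i y; apply/p0 => //.
  by rewrite (T0 im b); exact: (submod0 (cl_submod cY i)).
Qed.

End Step.

(* Zorn's lemma is applied to pairs of a closed subsystem Y of a resolution of W
   and a submodule V of the extension E mapping isomorphically onto aug_im Y,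
   both encoded in one subset of the sum of all T n and E. *)
Lemma small_injective_orth W Z :
  family_injective small_family Z -> wedge (@projective R) m W -> orth W Z.
Proof.
move=> Zinj [T [k [km TC TZ]]].
have Tp n : projective (T n).
  have [nk|kn] := leqP n k; first exact: TC.
  exact/zero_module_projective/TZ.
have T0 i : (m < i)%N -> zero_module (T i) by move=> mi; apply: TZ; apply: leq_ltn_trans mi.
pose l n := sval (cid (projective_dual_basis (Tp n))).
have lP n : dual_basis (l n) := svalP (cid (projective_dual_basis (Tp n))).
apply: orth_of_split => E i q [iI iq qs].
pose X := ({n : nat & T n} + E)%type.
pose Y (A : set X) n (x : T n) := A (inl (existT (fun n => T n : Type) n x)).
pose V (A : set X) (e : E) := A (inr e).
pose good (A : set X) := [/\ closed l (Y A), submod (V A), forall e, V A e -> q e = 0 -> e = 0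
  & forall w, (exists2 e, V A e & q e = w) <-> aug_im (Y A) w].
pose A0 : set X := fun x => match x with inl t => projT2 t = 0 | inr e => e = 0 end.
have sub0 M : submod (fun x : M => x = 0).
  by split=> // r x y -> ->; rewrite scaler0 addr0.
have [||A [[cY Vs V0 qV] Amax]] := @Zorn_set X good A0.
- split.
  + split=> [n|n y y0|n y y0 N a U Us Ua|n y y0 _].
    * exact: sub0.
    * by rewrite (y0 : y = 0); exact: linear0.
    * by rewrite (y0 : y = 0); have /= -> := linear0 (mk_linear ((lP n).2 N a)); apply: submod0.
    * by rewrite (y0 : y = 0); exists 0; [|exact: linear0].
  + exact: sub0.
  + by [].
  + move=> w; split=> [[e e0 <-]|[x x0 <-]]; exists 0; rewrite ?linear0 //.
      by rewrite (e0 : e = 0) linear0.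
    by rewrite (x0 : x = 0) linear0.
- move=> FF [A1 F1] Fgood Ftot.
  have up2 (x y : X) : (exists2 A : set X, FF A & A x) ->
      (exists2 A : set X, FF A & A y) -> exists A : set X, [/\ FF A, A x & A y].
    move=> [A FA Ax] [B FB By]; have [AB|BA] := Ftot _ _ FA FB.
      by exists B; split=> //; apply: AB.
    by exists A; split=> //; apply: BA.
  split.
  + split=> [n|n x [A FA Ax]|n x [A FA Ax] N a U Us Ua|n x [A FA Ax] cx].
    * split=> [|r x y Ax Ay].
        by exists A1 => //; have [/cl_submod c _ _ _] := Fgood _ F1; apply: (submod0 (c n)).
      have [A [FA Ax' Ay']] := up2 _ _ Ax Ay.
      exists A => //; have [/cl_submod c _ _ _] := Fgood _ FA.
      exact: (c n).2.
    * by exists A => //; have [/cl_diff c _ _ _] := Fgood _ FA; apply: c.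
    * have [/cl_basis c _ _ _] := Fgood _ FA; apply: (c n x Ax N a U Us) => y Ay.
      by apply: Ua; exists A.
    * have [/cl_exact c _ _ _] := Fgood _ FA; have [y Ay dy] := c n x Ax cx.
      by exists y => //; exists A.
  + split=> [|r x y Ax Ay].
      by exists A1 => //; have [_ c _ _] := Fgood _ F1; apply: (submod0 c).
    have [A [FA Ax' Ay']] := up2 _ _ Ax Ay.
    by exists A => //; have [_ c _ _] := Fgood _ FA; apply: c.2.
  + by move=> e [A FA Ae]; have [_ _ c _] := Fgood _ FA; apply: c.
  + move=> w; split=> [[e [A FA Ae] qe]|[x [A FA Ax] ax]].
      have [_ _ _ c] := Fgood _ FA; have [|x Ax ax] := (c w).1; first by exists e.
      by exists x => //; exists A.
    have [_ _ _ c] := Fgood _ FA; have [|e Ae qe] := (c w).2; first by exists x.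
    by exists e => //; exists A.
have YT n x : Y A n x.
  (* [closed_step] takes one element in each degree; only the one in degree n matters here. By
     maximality it suffices to enlarge the pair so that it contains x. *)
  have [g gx] : exists g : forall n, T n, g n = x.
    have gE j : exists y : T j, forall e : j = n, ecast j (T j) e y = x.
      have [jn|jn] := eqVneq j n; last by exists 0 => e; rewrite e eqxx in jn.
      by subst j; exists x => e; rewrite eq_axiomK.
    by exists (fun j => sval (cid (gE j))); apply: (svalP (cid (gE n)) erefl).
  have [Y' [a [cY' YY' Yg Y'aug [Us UUU]]]] := closed_step lP T0 cY g.
  set U := fun z => _ in Us UUU.
  have Fproj : projective F := free_projective univ ind.
  have [la laP] := Fproj _ _ q a qs.
  have /choice [v vP] : forall z, exists e, U z -> V A e /\ q e = a z.
    move=> z; case: (pselect (U z)) => [/qV [e Ve qe]|nU]; last by exists 0.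
    by exists e.
  have Vuniq e e' : V A e -> V A e' -> q e = q e' -> e = e'.
    move=> Ve Ve' qee'; apply/eqP; rewrite -subr_eq0; apply/eqP/V0; first exact: submodB.
    by rewrite linearB qee' subrr.
  have vL : linear_on U v.
    move=> r x0 y Ux Uy; have [Vx qx] := vP _ Ux; have [Vy qy] := vP _ Uy.
    have [Vxy qxy] := vP _ (Us.2 r _ _ Ux Uy).
    by apply: Vuniq => //; [apply: Vs.2|rewrite qxy !linearP qx qy].
  (* On U the lift [la] differs from the partial section by a map into Z. Its extension h to F,
     subtracted from [la], gives [nu], which agrees with the partial section on U. *)
  have /choice [f fP] : forall z, exists t, U z -> i t = la z - v z.
    move=> z; case: (pselect (U z)) => [Uz|nU]; last by exists 0.
    have [_ qv] := vP z Uz.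
    by have /iq [t tE] : q (la z - v z) = 0; [rewrite linearB laP qv subrr|exists t].
  have [||h hP] := Zinj U f.
  - by split.
  - move=> r x0 y Ux Uy; apply: iI; rewrite linearP !fP //; last exact: Us.2.
    by rewrite linearP vL // scalerBr opprD addrACA.
  have [nu nuE] : exists nu : {linear F -> E}, forall z, nu z = la z - i (h z).
    apply: linear_map => r x0 y.
    by rewrite (linearP h) (linearP i) (linearP la) scalerBr opprD addrACA.
  have qnu z : q (nu z) = a z.
    by rewrite nuE linearB laP [q (i _)](iq _).2 ?subr0 //; exists (h z).
  have nuU z : U z -> nu z = v z by move=> Uz; rewrite nuE hP // fP // subKr.
  pose V' e := exists e0 z, V A e0 /\ e = e0 + nu z.
  pose A' : set X := fun x => match x with inl t => Y' (projT1 t) (projT2 t) | inr e => V' e end.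
  have AA' : (A `<=` A')%classic.
    move=> [[j y] Ay|e Ae]; first exact: YY'.
    by exists e, 0; rewrite linear0 addr0.
  have gA' : good A'.
    split.
    - exact: cY'.
    - split=> [|r _ _ [e [z [Ve ->]]] [e' [z' [Ve' ->]]]].
        by exists 0, 0; rewrite linear0 addr0; split=> //; apply: (submod0 Vs).
      exists (r *: e + e'), (r *: z + z'); split; first exact: Vs.2.
      by rewrite linearP scalerDr addrACA.
    - move=> _ [e [z [Ve ->]]]; rewrite linearD qnu => /eqP; rewrite addr_eq0 => /eqP qe.
      have Uz : U z.
        apply/qV; exists (- e); first exact: submodN.
        by rewrite linearN qe opprK.
      have [Vv qv] := vP z Uz; rewrite nuU //.
      apply: V0; first exact: submodD.
      by rewrite linearD qe qv addNr.
    - move=> w; split=> [[_ [e [z [Ve ->]]] <-]|/Y'aug [_ [z [/qV [e Ve <-] ->]]]].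
        by apply/Y'aug; exists (q e), z; rewrite linearD qnu; split=> //; apply/qV; exists e.
      by exists (e + nu z); [exists e, z|rewrite linearD qnu].
  have : A' (inl (existT (fun n => T n : Type) n x)) by rewrite /A' /= -gx; apply: Yg.
  exact: Amax.
(* Y is now the whole resolution, so V maps isomorphically onto W. *)
have [] := @linear_rel R W E (fun w e => V A e /\ q e = w).
- move=> w; have [x ax] := @res_aug_surj _ _ T w.
  by have [|e Ve qe] := (qV w).2; [exists x|exists e].
- by move=> r x x' y y' [Vy qy] [Vy' qy']; rewrite linearP qy qy'; split=> //; apply: Vs.2.
- by move=> e [Ve qe]; apply: V0.
by move=> s sP; exists s => w; have [_] := sP w.
Qed.

End SmallFamily.

(** An m-th cosyzygy is orthogonal to every F/U in the family, hence relatively injective. So A is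
    orthogonal to all m-th cosyzygies, and [pdim_projectiveP] applies. *)
Lemma wedge_projective_envelope (R : pzRingType) m (N : lmodType R) :
  exists B A, [/\ ses N B A, forall W, wedge (@projective R) m W -> orth W B
    & wedge (@projective R) m A].
Proof.
have [F [inc [univ ind]]] := free_module R (rterm R 0).
have Fp := free_projective univ ind.
have [|B [A [sN Binj oA]]] := @family_envelope R F (small_family m (F := F)) Fp _ N.
  by move=> U [].
exists B, A; split=> //; first by move=> W; apply: (small_injective_orth univ ind Binj).
have rP := resolving_projective R.
apply/(wedgeP _ _ rP)/pdim_projectiveP => Z cZ; apply: oA => U f [Us [Q [r [rs rU wQ]]]] fL.
have /pdim_projectiveP oQ := (wedgeP m Q rP).1 wQ.
have [|g gP] := oQ Z cZ F r rs f; first by move=> c x y /rU Ux /rU Uy; apply: fL.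
by exists g => x /rU; apply: gP.
Qed.

(** * The cotorsion pair *)

Section GorensteinProjectives.
Variables (R : pzRingType) (L : modclass R).
Implicit Types (A B D E G I J K M N P Q S V W Y Z : lmodType R).

Lemma GProj_cosyzygy M : GProj L M -> exists P K, [/\ ses M P K, projective P & GProj L K].
Proof.
move=> [T [Tp Tex TL [i [j [jI jd]]]]].
(* [is_cycle] speaks of degrees written as i + 1; this rewriting puts the image K, which sits in
   degree i, into that form. *)
have [i' E] : exists i', i = i' + 1 by exists (i - 1); rewrite subrK.
subst i.
have [K [k [kI kP]]] := sub_module (submod_im (cpx_diff T (i' + 1))).
have [] := @linear_rel R (T (i' + 1 + 1)) K (fun x y => k y = cpx_diff T (i' + 1) x).
- by move=> x; apply/kP; exists x.
- by move=> r x x' y y'; rewrite !linearP => -> ->.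
- by move=> y; rewrite !linear0; apply: inj0.
move=> q qP; exists (T (i' + 1 + 1)), K; split=> //.
  exists j, q; split=> // [x|y].
    by rewrite -jd; split=> [qx|dx]; [rewrite -qP qx linear0|apply: (inj0 kI); rewrite qP].
  by have /kP [x xE] : exists s, k s = k y; [exists y|exists x; apply: kI; rewrite qP].
exists T; split=> //; exists i', k; split=> // y.
by rewrite -kP; apply: Tex.
Qed.

(** By exactness the cycle M is the image of the differential entering its degree. *)
Lemma GProj_cover M : GProj L M -> exists (T : zcomplex R) (i : int)
  (p : {linear T (i + 1 + 1) -> M}),
  [/\ forall i, projective (T i), exact_complex T, forall N, L N -> Hom_exact_complex T N,
      surj_map p & forall x, p x = 0 <-> cpx_diff T (i + 1) x = 0].
Proof.
move=> [T [Tp Tex TL [i [j [jI jd]]]]].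
have [] := @linear_rel R (T (i + 1 + 1)) M (fun x y => j y = cpx_diff T (i + 1) x).
- by move=> x; apply/jd/Tex; exists x.
- by move=> r x x' y y'; rewrite !linearP => -> ->.
- by move=> y; rewrite !linear0; apply: inj0.
move=> p pP; exists T, i, p; split=> // [y|x].
  have /Tex [x dx] : cpx_diff T i (j y) = 0 by apply/jd; exists y.
  by exists x; apply: jI; rewrite pP.
by split=> [px|dx]; [rewrite -pP px linear0|apply: (inj0 jI); rewrite pP].
Qed.

Lemma GProj_syzygy M : GProj L M -> exists K P, [/\ ses K P M, projective P & GProj L K].
Proof.
move=> /GProj_cover [T [i [p [Tp Tex TL ps pd]]]].
have [K [k se]] := ses_of_surj ps; exists K, (T (i + 1 + 1)); split=> //.
  by exists k, p.
case: se => kI kp _; exists T; split=> //; exists (i + 1), k; split=> // y.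
by rewrite -pd; apply: kp.
Qed.

(** Composed with the next differential, f becomes a cocycle of Hom(T, N); a map that bounds it
    extends f. *)
Lemma GProj_orth M N : GProj L M -> L N -> orth M N.
Proof.
move=> /GProj_cover [T [i [p [Tp Tex TL ps pd]]]] LN.
apply: (orth_of_proj (Tp _) ps) => f fL.
have [|f' f'E] := @linear_map R _ N (fun x => f (cpx_diff T (i + 1 + 1) x)).
  by move=> r x y; rewrite linearP fL //; apply/pd/Tex; [exists x|exists y].
have [|g gP] := (TL N LN (i + 1 + 1) f').1.
  move=> x; rewrite f'E cpx_diffK (linear_on0 _ fL) //; exact: linear0.
by exists g => z /pd /Tex [x <-]; rewrite -gP f'E.
Qed.

(** The coresolving sequence of P has a projective cokernel, so it splits and P is a retract of a
    module in L. *)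
Lemma GProj_orth_projective M P : GP_admissible (@projective R) L ->
  GProj L M -> projective P -> orth M P.
Proof.
move=> adm GM Pp; have [W [A [f [g [se Ap [_ LW]]]]]] := GPa_cogen adm Pp.
have [r rf] := orth_retraction (projective_orth (N := P) Ap) se.
by apply: (orth_retractr rf); apply: GProj_orth.
Qed.

End GorensteinProjectives.

(** * The construction for an abstract class C with syzygies and cosyzygies *)

Section GorensteinCotorsionPair.
Variables (R : pzRingType) (C : modclass R).
Implicit Types (A B D E G I J K M N P Q S V W Y Z : lmodType R).

Definition orth_class N : Prop := forall M, C M -> orth M N.

Hypotheses (CP : forall M, C M <-> forall N, orth_class N -> orth M N)
  (Ccov : forall M, exists B A, [/\ ses B A M, C A & orth_class B])
  (Csyz : forall M, C M -> exists K P, [/\ ses K P M, projective P & C K])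
  (Ccosyz : forall M, C M -> exists P K, [/\ ses M P K, projective P & C K])
  (Cproj : forall P, projective P -> orth_class P).

(** As a left orthogonal class C is closed under extensions and retracts; one syzygy in C then
    forces all others into C by [ses_kernel]. *)
Lemma cotorsion_resolving : resolving C.
Proof.
have pC P : projective P -> C P by move=> Pp; apply/CP => N _; apply: projective_orth.
have eC A B D : ses A B D -> C A -> C D -> C B.
  move=> s /CP cA /CP cD; apply/CP => N oN.
  exact: orth_extl s (cA N oN) (cD N oN).
have rC A B (i : {linear A -> B}) (r : {linear B -> A}) :
    (forall x, r (i x) = x) -> C B -> C A.
  move=> ri /CP cB; apply/CP => N oN; exact: orth_retractl ri (cB N oN).
split=> // K P M sK Pp /Csyz [K' [P' [sK' Pp' CK']]].
exact: (ses_kernel eC rC sK sK' Pp' (pC _ Pp)).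
Qed.

(** P is right orthogonal to C and takes the place of I in [orth_cokernel]; the syzygy of M can be
    taken in C. *)
Lemma pdim_projective_orth_class n W : pdim_le (@projective R) n W -> orth_class W.
Proof.
elim: n W => [|n IH] W /=; first exact: Cproj.
move=> [W' [P [sW Pp /IH oW']]] M CM; have [K [Q [sK Qp CK]]] := Csyz CM.
exact: (orth_cokernel sK Qp sW (Cproj Pp CM) (oW' K CK)).
Qed.

(** With K embedded in W, the pushout E of P and W over K is an extension of V by P, hence in C.
    Embedding E in a projective Q, the quotient X of Q by W has W as syzygy and contains M = E/W
    with cokernel in C. *)
Lemma pdim_embedding n M : pdim_le C n M ->
  exists W V, [/\ ses M W V, pdim_le (@projective R) n W & C V].
Proof.
elim: n M => [|n IH] M /=.
  by move=> /Ccosyz [P [K [sM Pp CK]]]; exists P, K.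
move=> [K [P [sK Pp /IH [W [V [sW pW CV]]]]]].
have [E sE sE'] := pushout_ses sK sW.
have rC := cotorsion_resolving.
have /Ccosyz [Q [G [sQ Qp CG]]] : C E by apply: (rsv_ext rC sE') => //; apply: rsv_proj.
have [X sX sX'] := ses_inj_comp sE sQ.
by exists X, G; split=> //; exists W, Q.
Qed.

Definition pdim_orth_class n N : Prop :=
  (forall W, pdim_le (@projective R) n W -> orth W N) /\ orth_class N.

(** M is the kernel of W -> V, and V has a syzygy in C; so [ses_kernel] applies to the class of
    modules left orthogonal to N. *)
Lemma pdim_orth n M N : pdim_le C n M -> pdim_orth_class n N -> orth M N.
Proof.
move=> /pdim_embedding [W [V [sM pW /Csyz [K [P [sK Pp CK]]]]]] [oW oN].
apply: (ses_kernel (C := fun M => orth M N) _ _ sM sK Pp (oW _ pW) (oN _ CK)) => A B.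
  by move=> D s; apply: orth_extl s.
by move=> i r ri; apply: orth_retractl ri.
Qed.

Lemma pdim_cover n M : exists B A,
  [/\ ses B A M, pdim_le C n A & pdim_orth_class n B].
Proof.
have rC := cotorsion_resolving; have rP := resolving_projective R.
have [Y [G [sM CG oY]]] := Ccov M.
have [B [A [sY oB /(wedgeP _ _ rP) pA]]] := wedge_projective_envelope n Y.
have [E sE sE'] := pushout_ses sM sY.
exists B, E; split=> //.
  apply: (rsv_ext (pdim_le_resolving n rC) sE').
    exact: (@pdim_le_mono _ C 0).
  by apply: pdim_le_sub pA; apply: rsv_proj.
split=> [W /(wedgeP _ _ rP) /oB //|M' CM'].
(* B is an extension of A by Y, and A is right orthogonal to C because its projective dimension is
   finite. *)
apply: (orth_extr sY); first exact: oY.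
exact: pdim_projective_orth_class pA M' CM'.
Qed.

End GorensteinCotorsionPair.

Theorem theorem3p16 (R : pzRingType) (L : modclass R)
  (L_adm : GP_admissible (@projective R) L)
  (GP_cot : complete_cotorsion_pair (GProj L) (right_perp1 (GProj L)))
  (m : nat) (m_gt0 : (0 < m)%N) :
  complete_cotorsion_pair
    (wedge (GProj L) m)
    (class_cap (right_perp1 (wedge (@projective R) m))
               (right_perp1 (GProj L))) /\
  hereditary_pair
    (wedge (GProj L) m)
    (class_cap (right_perp1 (wedge (@projective R) m))
               (right_perp1 (GProj L))).
Proof.
have [[GL _] Gcomp] := GP_cot.
have perpE (X : modclass R) N : right_perp1 X N <-> orth_class X N.
  by split=> oN M /oN /Ext1_orth.
have CP M : GProj L M <-> forall N, orth_class (GProj L) N -> orth M N.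
  split=> [/GL oM N /perpE /oM /Ext1_orth //|oM].
  by apply/GL => N /perpE /oM /Ext1_orth.
have Ccov M : exists B A, [/\ ses B A M, GProj L A & orth_class (GProj L) B].
  have [B [A [f [g [se GA /perpE oB]]]]] := Gcomp M.
  by exists B, A; split=> //; exists f, g.
have Csyz := @GProj_syzygy R L; have Ccosyz := @GProj_cosyzygy R L.
have Cproj P : projective P -> orth_class (GProj L) P.
  by move=> Pp M GM; apply: GProj_orth_projective L_adm GM Pp.
have rC := cotorsion_resolving CP Csyz; have rP := resolving_projective R.
have capE N : class_cap (right_perp1 (wedge (@projective R) m)) (right_perp1 (GProj L)) N <->
    pdim_orth_class (GProj L) m N.
  split=> [[/perpE oP /perpE oG]|[oP oG]]; split=> //.
  - by move=> W /(wedgeP _ _ rP); apply: oP.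
  - by apply/perpE => W /(wedgeP _ _ rP); apply: oP.
  - exact/perpE.
have orthX M N : wedge (GProj L) m M ->
    class_cap (right_perp1 (wedge (@projective R) m)) (right_perp1 (GProj L)) N -> orth M N.
  by move=> /(wedgeP _ _ rC) pM /capE oN; apply: (pdim_orth CP Csyz Ccosyz pM oN).
have cover := pdim_cover CP Ccov Csyz Cproj m.
split; first split; first split.
- move=> M; split=> [wM N cN|oM]; first by apply/Ext1_orth; apply: orthX.
  have [B [A [[i [p se]] pA /capE cB]]] := cover M.
  (* M is orthogonal to B, so its cover splits and M is a retract of A. *)
  have [s ps] := orth_split ((Ext1_orth _ _).1 (oM B cB)) se.
  apply/(wedgeP _ _ rC).
  exact: (rsv_retract (pdim_le_resolving m rC) ps pA).
- move=> N; split=> [cN M wM|oN]; first by apply/Ext1_orth; apply: orthX.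
  apply/capE; split=> [W pW|M GM]; apply/Ext1_orth/oN/(wedgeP _ _ rC).
    by apply: pdim_le_sub pW; apply: rsv_proj.
  exact: (@pdim_le_mono _ (GProj L) 0).
- move=> M; have [B [A [[i [p se]] /(wedgeP _ _ rC) wA /capE cB]]] := cover M.
  by exists B, A, i, p.
(* Higher Ext reduces to Ext^1, since syzygies of modules in the left class stay there. *)
- case=> // i A N _; elim: i A => [|i IH] A wA cN; first by apply/Ext1_orth; apply: orthX.
  have [K [P [sK Pp]]] := syzygy_exists A.
  apply: (Ext_shift sK Pp); apply: IH => //; apply/(wedgeP _ _ rC).
  by apply: (rsv_syz (pdim_le_resolving m rC) sK Pp); apply/(wedgeP _ _ rC).
Qed.
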